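(* Let $\widehat{\mathbf Y}$ be an optimal solution of the SDP and let $\widehat{\boldsymbol\sigma}=\texttt{cluster}(\widehat{\mathbf Y},n,k)$ be the output of the rounding procedure described in the context (for any choice of the arbitrary steps). Then \[ \mathrm{err}(\widehat{\boldsymbol\sigma},\boldsymbol\sigma^* )\le C\,\frac{\|\widehat{\mathbf Y}-\mathbf Y^*\|_1}{\|\mathbf Y^*\|_1} \] for a universal constant $C>0$. Consequently, under the Sub-Gaussian Mixture Model, there exist universal constants $C_s,C_m,C_e>0$ such that if $s^2\ge C_s\left(\sqrt{\frac{kd}{n}\log n}+\frac{kd}{n}+k\right)$, then \[ \mathrm{err}(\widehat{\boldsymbol\sigma},\boldsymbol\sigma^* )\le C_m\exp\left[-\frac{s^2}{C_e}\right] \] with probability at least $1-2n^{-1}$.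
   Context: Sub-Gaussian norm: $\|X\|_{\psi_2}=\inf\{t>0:\mathbb E\exp(X^2/t^2)\le 2\}$ for real $X$; $\|\mathbf x\|_{\psi_2}=\sup_{\|\mathbf u\|_2=1}\|\langle\mathbf x,\mathbf u\rangle\|_{\psi_2}$ for random vectors. Model: integers $n\ge 4$, $k\ge 2$ with $k\mid n$; centers $\boldsymbol\mu_1,\dots,\boldsymbol\mu_k\in\mathbb R^d$; labels $\boldsymbol\sigma^*=(\sigma^*_1,\dots,\sigma^*_n)\in[k]^n$ with each cluster $\{i:\sigma^*_i=a\}$ of size $\ell=n/k$. Observations $\mathbf h_i=\boldsymbol\mu_{\sigma^*_i}+\mathbf g_i$ with $\mathbf g_i$ independent sub-Gaussian random vectors, $\|\mathbf g_i\|_{\psi_2}\le\tau$. $\Delta=\min_{a\ne b}\|\boldsymbol\mu_a-\boldsymbol\mu_b\|_2$, $s=\Delta/\tau$. SDP: $A_{ij}=\|\mathbf h_i-\mathbf h_j\|_2^2$; $\widehat{\mathbf Y}$ minimizes $\langle\mathbf Y,\mathbf A\rangle$ over $\mathbf Y\in\mathbb R^{n\times n}$ subject to $\mathbf Y\mathbf 1_n=\frac nk\mathbf 1_n$, $\mathbf Y\succeq0$, $\mathrm{diag}(\mathbf Y)=\mathbf 1_n$, $\mathbf Y\ge0$. $Y^*_{ij}=\mathbb 1\{\sigma^*_i=\sigma^*_j\}$; $\|\cdot\|_1$ is the entrywise $\ell_1$ norm; $\widehat{\mathbf Y}_{u\bullet}$ is the $u$-th row. Rounding $\texttt{cluster}$: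 Step 1: set $V=[n]$, $B_0=\emptyset$, $t=0$; while $V\setminus\bigcup_{i\le t}B_i\neq\emptyset$: increase $t$ by one, let $V_t=V\setminus\bigcup_{i<t}B_i$, for each $u\in V_t$ let $B(u)=\{w\in V_t:\|\widehat{\mathbf Y}_{u\bullet}-\widehat{\mathbf Y}_{w\bullet}\|_1\le \frac{n}{4k}\}$, let $B_t$ be a set $B(u)$, $u\in V_t$, of maximum cardinality, and if $|B_t|>n/k$ remove arbitrary elements so that $|B_t|=n/k$. Step 2: among the resulting sets $\{B_t\}_{t\ge1}$ choose $k$ of largest cardinality, call them $U_1,\dots,U_k$; distribute the elements of the remaining sets arbitrarily among $U_1,\dots,U_k$ so that each $U_t$ has exactly $n/k$ elements; set $\widehat\sigma_i=t$ for the unique $t$ with $i\in U_t$. Error: $\mathrm{err}(\widehat{\boldsymbol\sigma},\boldsymbol\sigma^* )=\min_{\pi\in S_k}\frac1n|\{i\in[n]:\widehat\sigma_i\ne\pi(\sigma^*_i)\}|$, $S_k$ the permutations of $[k]$. *)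

(* Defs.v *)
From HB Require Import structures.
From mathcomp Require Import all_boot all_order all_algebra all_fingroup.
From mathcomp Require Import all_classical all_reals all_analysis.
Set Implicit Arguments. Unset Strict Implicit. Unset Printing Implicit Defensive.
Import Order.TTheory GRing.Theory Num.Theory.
Local Open Scope ring_scope.

Section Defs.
Variable R : realType.

Definition dotv (d : nat) (x y : 'rV[R]_d) : R := \sum_(l < d) x 0 l * y 0 l.
Definition sqnorm (d : nat) (x : 'rV[R]_d) : R := \sum_(l < d) x 0 l ^+ 2.
Definition enorm (d : nat) (x : 'rV[R]_d) : R := Num.sqrt (sqnorm x).

Definition is_min_sep (k d : nat) (mu : 'I_k -> 'rV[R]_d) (Delta : R) : Prop :=
  (exists a b : 'I_k, a != b /\ enorm (mu a - mu b) = Delta) /\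
  (forall a b : 'I_k, a != b -> Delta <= enorm (mu a - mu b)).

Definition balanced (n k : nat) (sig : 'I_n -> 'I_k) : Prop :=
  forall a : 'I_k, #|[set i | sig i == a]| = (n %/ k)%N.

Definition Amat (n d : nat) (h : 'I_n -> 'rV[R]_d) : 'M[R]_n :=
  \matrix_(i, j) sqnorm (h i - h j).

Definition frob (n : nat) (Y A : 'M[R]_n) : R := \sum_i \sum_j Y i j * A i j.

Definition psd (n : nat) (Y : 'M[R]_n) : Prop :=
  Y^T = Y /\ forall x : 'cV[R]_n, 0 <= (x^T *m Y *m x) 0 0.

Definition sdp_feasible (n k : nat) (Y : 'M[R]_n) : Prop :=
  [/\ (forall i, \sum_j Y i j = n%:R / k%:R), psd Y,
      (forall i, Y i i = 1) & (forall i j, 0 <= Y i j)].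

Definition sdp_opt (n k : nat) (A : 'M[R]_n) (Y : 'M[R]_n) : Prop :=
  sdp_feasible k Y /\ forall Y' : 'M[R]_n, sdp_feasible k Y' -> frob Y A <= frob Y' A.

Definition Ystar (n k : nat) (sig : 'I_n -> 'I_k) : 'M[R]_n :=
  \matrix_(i, j) (sig i == sig j)%:R.

Definition l1 (n : nat) (M : 'M[R]_n) : R := \sum_i \sum_j `|M i j|.

Definition row_dist (n : nat) (Y : 'M[R]_n) (u w : 'I_n) : R :=
  \sum_j `|Y u j - Y w j|.

Definition Bball (n k : nat) (Y : 'M[R]_n) (V : {set 'I_n}) (u : 'I_n) : {set 'I_n} :=
  [set w in V | row_dist Y u w <= n%:R / (4 * k%:R)].

(* V_t = V \ (B_1 u ... u B_{t-1}), with Bs indexed from 0 *)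
Definition Vt (n : nat) (Bs : seq {set 'I_n}) (t : nat) : {set 'I_n} :=
  ~: \big[@finset.setU _/finset.set0]_(i < t) nth finset.set0 Bs i.

Definition step1 (n k : nat) (Y : 'M[R]_n) (Bs : seq {set 'I_n}) : Prop :=
  (forall t, (t < size Bs)%N ->
     let V := Vt Bs t in
     let B := nth finset.set0 Bs t in
     exists u, [/\ u \in V,
        (forall u', u' \in V -> #|Bball k Y V u'| <= #|Bball k Y V u|)%N &
        (if (#|Bball k Y V u| <= n %/ k)%N then B = Bball k Y V u
         else B \subset Bball k Y V u /\ #|B| = (n %/ k)%N)]) /\
  Vt Bs (size Bs) = finset.set0.

Definition cluster_out (n k : nat) (Y : 'M[R]_n) (sig : 'I_n -> 'I_k) : Prop :=
  exists Bs : seq {set 'I_n}, step1 k Y Bs /\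
  exists sel : 'I_k -> 'I_(size Bs),
    [/\ injective sel,
        (forall t : 'I_(size Bs), t \notin codom sel ->
           forall j, #|nth finset.set0 Bs t| <= #|nth finset.set0 Bs (sel j)|)%N,
        (forall j, nth finset.set0 Bs (sel j) \subset [set i | sig i == j]) &
        (forall j, #|[set i | sig i == j]| = (n %/ k)%N)].

Definition mismatch (n k : nat) (sig sig' : 'I_n -> 'I_k) (p : {perm 'I_k}) : nat :=
  #|[set i | sig i != p (sig' i)]|.

Definition err (n k : nat) (sig sig' : 'I_n -> 'I_k) : R :=
  (\big[minn/n]_(p : {perm 'I_k}) mismatch sig sig' p)%:R / n%:R.

End Defs.
Arguments err {R n k} sig sig'.
Arguments Ystar {R n k} sig.

Section Prob.
Local Open Scope classical_set_scope.
Local Open Scope ereal_scope.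
Context {R : realType} {dT : measure_display} {T : measurableType dT}.
Variable P : probability T R.

(* ||X||_psi2 = inf { t > 0 : E exp(X^2/t^2) <= 2 }  (in \bar R; +oo if empty) *)
Definition psi2_norm (X : T -> R) : \bar R :=
  ereal_inf [set t%:E | t in [set t : R | (0 < t)%R /\
     \int[P]_w (expR (X w ^+ 2 / t ^+ 2))%:E <= 2%:E]].

Definition subg_norm (d : nat) (g : T -> 'rV[R]_d) : \bar R :=
  ereal_sup [set psi2_norm (fun w => dotv (g w) u) | u in [set u | enorm u = 1%R]].

Definition rvec_gen (d : nat) (g : T -> 'rV[R]_d) : set (set T) :=
  [set S | exists (j : 'I_d) (B : set R), measurable B /\ S = (fun w => g w ord0 j) @^-1` B].

Definition indep_rvecs (n d : nat) (g : 'I_n -> T -> 'rV[R]_d) : Prop :=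
  forall A : 'I_n -> set T, (forall i, <<s rvec_gen (g i) >> (A i)) ->
    P (\bigcap_(i in [set: 'I_n]) A i) = \prod_(i < n) P (A i).

End Prob.

(* Main.v *)
(* Idea of the exponential rate.  Comparing the SDP optimum Y with the planted
   matrix and splitting the data into cluster averages and residuals gives, for
   the empirical centers m_a,
     0 <= sum over pairs (i,j) in different clusters of
       Y_ij (2 <m_b - m_a, g_i - avg_a> - |m_b - m_a|^2 / 2 + Lam / l),
   where a, b are the clusters of i and j and l = n / k.  The quadratic residual
   term is controlled by Lam >= |G|_op^2 because Y is positive semidefinite with
   unit diagonal; Lam <= C tau^2 (n + d) follows from a union bound over integer
   points, to which a vector is rounded coordinate by coordinate by convexity.

   The remaining term <m_b - m_a, g_i> couples the noise with itself through the
   cluster averages.  It is at most the average, over the subsets J of the sample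
   that avoid i, of <v_J, g_i>, where v_J only involves the noise in J.  By
   Jensen the exponential moment of the total excess is at most the average over
   J of a product over i outside J, whose mean is computed by integrating out
   one g_i at a time.  No centering of the noise is used, and of the condition on
   s^2 only the part s^2 >= C (k + k d / n) is needed.

   Rounding: rows of Y within l/8 of their planted row are good.  A ball meets the
   good rows of one cluster only, and the greedy choice makes the first block that
   meets the good rows of a cluster at least as large as their number. *)
Require Import Defs.
From HB Require Import structures.
From mathcomp Require Import all_boot all_order all_algebra all_fingroup.
From mathcomp Require Import all_classical all_reals all_analysis.
From mathcomp Require Import ring lra zify.
From mathcomp Require Import measurable_realfun.

Set Implicit Arguments. Unset Strict Implicit. Unset Printing Implicit Defensive.
Import Order.TTheory GRing.Theory Num.Theory.
Import numFieldNormedType.Exports.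
Local Open Scope classical_set_scope.
Local Open Scope ring_scope.

(** * Independence *)

Section IndependentPair.
Local Open Scope ereal_scope.
Context {R : realType} {dT dA dB : measure_display} {T : measurableType dT}
  {TA : measurableType dA} {TB : measurableType dB}.
Variables (P : probability T R) (X : T -> TA) (Y : T -> TB).
Hypothesis mX : measurable_fun setT X.
Hypothesis mY : measurable_fun setT Y.
Hypothesis indepXY : forall A B, measurable A -> measurable B ->
  P (X @^-1` A `&` Y @^-1` B) = P (X @^-1` A) * P (Y @^-1` B).

Let XY : T -> TA * TB := fun w => (X w, Y w).

Let mXY : measurable_fun setT XY.
Proof. exact: measurable_fun_pair. Qed.

HB.instance Definition _ := isMeasurableFun.Build _ _ _ _ X mX.
HB.instance Definition _ := isMeasurableFun.Build _ _ _ _ Y mY.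
HB.instance Definition _ := isMeasurableFun.Build _ _ _ _ XY mXY.

(** The joint law agrees with the product of the marginals on rectangles, hence everywhere by
    uniqueness of the product measure; Tonelli then splits the integral. *)
Lemma independent_pair_integral (F : TA * TB -> \bar R) :
  measurable_fun setT F -> (forall z, 0 <= F z) ->
  \int[P]_w F (X w, Y w) = \int[P]_w \int[P]_w' F (X w, Y w').
Proof.
move=> mF F0.
have -> : \int[P]_w F (X w, Y w) = \int[distribution P XY]_z F z.
  by rewrite ge0_integral_distribution.
transitivity (\int[distribution P X \x distribution P Y]_z F z).
  apply: eq_measure_integral => C mC _; apply/esym.
  exact: (@product_measure_unique _ _ _ _ _ (distribution P X)
    (distribution P Y) (distribution P XY)).
rewrite fubini_tonelli1 // ge0_integral_distribution //=.
- apply: eq_integral => w _.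
  rewrite /fubini_F /= ge0_integral_distribution //.
  exact: measurableT_comp.
- exact: measurable_fun_fubini_tonelli_F.
- by move=> x; apply: integral_ge0.
Qed.

Lemma measurable_partial_integral (F : TA * TB -> \bar R) :
  measurable_fun setT F -> (forall z, 0 <= F z) ->
  measurable_fun setT (fun w => \int[P]_w' F (X w, Y w')).
Proof.
move=> mF F0.
have -> : (fun w => \int[P]_w' F (X w, Y w')) =
    fubini_F (distribution P Y) F \o X.
  apply/funext => w /=.
  rewrite /fubini_F ge0_integral_distribution //.
  exact: measurableT_comp.
exact: measurableT_comp (measurable_fun_fubini_tonelli_F _ mF F0) mX.
Qed.

End IndependentPair.

Section IndependentVectors.
Local Open Scope ereal_scope.
Context {R : realType} {dT : measure_display} {T : measurableType dT}.
Variables (P : probability T R) (n d : nat) (g : 'I_n -> T -> 'rV[R]_d).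
Hypothesis mg : forall i j, measurable_fun setT (fun w => g i w ord0 j).
Hypothesis indep : indep_rvecs P g.

Definition others_gen (i : 'I_n) : set (set T) :=
  [set S | exists2 j, j != i & rvec_gen (g j) S].

Lemma rvec_gen_measurable i : rvec_gen (g i) `<=` measurable.
Proof.
move=> _ [j [B [mB ->]]].
by rewrite -[X in measurable X]setTI; exact: mg.
Qed.

Lemma others_gen_measurable i : others_gen i `<=` measurable.
Proof. by move=> S [j _]; exact: rvec_gen_measurable. Qed.

Lemma gen_sub_measurable (G : set (set T)) :
  G `<=` measurable -> <<s G >> `<=` measurable.
Proof.
by move=> Gm; apply: smallest_sub => //; exact: sigma_algebra_measurable.
Qed.

(** A pi-lambda argument in [A] with [B] fixed. The sets satisfying the product rule form a lambda
    system [H], and the pi-system [Pi] of intersections leaving slot [i] free generates the events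
    of the other vectors. *)
Lemma others_indep i A B : <<s others_gen i >> A -> <<s rvec_gen (g i) >> B ->
  P (A `&` B) = P A * P B.
Proof.
move=> sA sB.
have mB : measurable B by exact: gen_sub_measurable (@rvec_gen_measurable i) _ sB.
pose Pi : set (set T) := [set S | exists F : 'I_n -> set T,
  [/\ forall j, <<s rvec_gen (g j) >> (F j), F i = setT &
      S = \bigcap_(j in [set: 'I_n]) F j]].
have mF (F : 'I_n -> set T) : (forall j, <<s rvec_gen (g j) >> (F j)) ->
    forall j, measurable (F j).
  by move=> sF j; exact: gen_sub_measurable (@rvec_gen_measurable j) _ (sF j).
have mcap (F : 'I_n -> set T) : (forall j, measurable (F j)) ->
    measurable (\bigcap_(j in [set: 'I_n]) F j).
  by move=> mFj; apply: fin_bigcap_measurable => // j _; exact: finite_finset.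
pose H : set (set T) := [set S | measurable S /\ P (S `&` B) = P S * P B].
have PiH : Pi `<=` H.
  move=> S [F [sF Fi ->]]; split; first exact/mcap/mF.
  (* Slot [i] of [F] is the whole space, so intersecting with [B] amounts to filling that slot;
     [indep] then applies to both families. *)
  pose F' j := if j == i then B else F j.
  have -> : \bigcap_(j in [set: 'I_n]) F j `&` B =
            \bigcap_(j in [set: 'I_n]) F' j.
    apply/seteqP; split=> [w [wF wB] j _|w wF'].
      by rewrite /F'; case: ifP => // _; exact: wF.
    split; last by have := wF' i I; rewrite /F' eqxx.
    move=> j _; have := wF' j I; rewrite /F'; case: eqP => [->|//].
    by rewrite Fi.
  rewrite !indep//; last by move=> j; rewrite /F'; case: eqP => // ->.
  rewrite (bigD1 i)//= [in RHS](bigD1 i)//= /F' eqxx Fi probability_setT mul1e.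
  rewrite muleC; congr (_ * _).
  by apply: eq_bigr => j /negbTE ->.
suff : <<s Pi >> `<=` H.
  move/(_ A) => HA; apply HA.
  apply: (sub_sigma_algebra2 (M := others_gen i)) sA.
  move=> S [j ji Sj].
  exists (fun j' => if j' == j then S else setT); split.
  - move=> j'; case: eqP => [->|_]; first exact: sub_sigma_algebra.
    exact: (@measurableT _ (g_sigma_algebraType (rvec_gen (g j')))).
  - by rewrite eq_sym (negbTE ji).
  - apply/seteqP; split=> [w Sw j' _|w /(_ j I)]; last by rewrite eqxx.
    by case: ifP.
apply: lambda_system_subset.
- move=> _ _ [F [sF Fi ->]] [F' [sF' Fi' ->]].
  exists (fun j => F j `&` F' j); split.
  + move=> j; exact: (@measurableI _ (g_sigma_algebraType (rvec_gen (g j)))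
      _ _ (sF j) (sF' j)).
  + by rewrite Fi Fi' setIT.
  + by rewrite bigcapI.
- apply/dynkin_lambda_system; split.
  + by split => //; rewrite setTI probability_setT mul1e.
  + move=> S [mS eS]; split; first exact: measurableC.
    have -> : P (~` S `&` B) = P B - P (S `&` B).
      rewrite setIC -setDE measureD// ?(setIC B)//.
      by rewrite ltey_eq fin_num_measure.
    rewrite eS probability_setC// muleBl ?mul1e ?fin_num_measure//.
  + move=> F tF HF; have mFn k : measurable (F k) by have [] := HF k.
    split; first exact: bigcupT_measurable.
    rewrite setI_bigcupl !measure_bigcup//.
    * rewrite (eq_eseriesr (fun k _ => (HF k).2)) muleC.
      under eq_eseriesr do rewrite muleC.
      by rewrite -(fineK (fin_num_measure P _ mB)) nneseriesZl.
    * by move=> k _; apply: measurableI.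
    * by apply: trivIset_setIr.
- exact: PiH.
- by [].
Qed.

(** The sample space itself with a coarser sigma-algebra. The identity maps into [others_type] and
    [self_type] serve as the two independent variables, so functions of the sample point need not be
    rewritten in terms of the vectors. *)
Definition others_type (i : 'I_n) : measurableType (others_gen i).-sigma :=
  g_sigma_algebraType (others_gen i).

Definition self_type (i : 'I_n) : measurableType (rvec_gen (g i)).-sigma :=
  g_sigma_algebraType (rvec_gen (g i)).

Lemma measurable_id_others i :
  measurable_fun [set: T] (id : T -> others_type i).
Proof.
move=> _ Y mY; rewrite setTI.
exact: gen_sub_measurable (@others_gen_measurable i) _ mY.
Qed.

Lemma measurable_id_self i : measurable_fun [set: T] (id : T -> self_type i).
Proof.
move=> _ Y mY; rewrite setTI.
exact: gen_sub_measurable (@rvec_gen_measurable i) _ mY.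
Qed.

Lemma measurable_coord_others i j l : j != i ->
  measurable_fun [set: others_type i] (fun w => g j w ord0 l).
Proof.
move=> ji _ Y mY; rewrite setTI.
by apply: sub_sigma_algebra; exists j => //; exists l, Y.
Qed.

Lemma measurable_coord_self i l :
  measurable_fun [set: self_type i] (fun w => g i w ord0 l).
Proof.
by move=> _ Y mY; rewrite setTI; apply: sub_sigma_algebra; exists l, Y.
Qed.

(* The vectors are integrated out one at a time: F i w w' depends on g i through
   w' only and on the other vectors through w. *)
Lemma le_integral_prod (F : 'I_n -> T -> T -> R) (c : R) (s : seq 'I_n) :
  uniq s -> (forall i w w', 0 <= F i w w')%R ->
  (forall i, i \in s ->
    measurable_fun [set: others_type i * self_type i]
      (fun z => F i z.1 z.2)) ->
  (forall i j, i \in s -> j \in s -> j != i ->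
    measurable_fun [set: others_type i] (fun w => F j w w)) ->
  (forall i w, i \in s -> \int[P]_w' (F i w w')%:E <= c%:E) ->
  \int[P]_w (\prod_(i <- s) F i w w)%:E <= (c ^+ size s)%:E.
Proof.
move=> + F0; elim: s => [|i s IHs] /= us mF mFd intF.
  under eq_integral do rewrite big_nil.
  rewrite integral_cst// mul1e.
  by rewrite [X in X <= _](probability_setT P).
have /andP[nis us'] := us.
(* The product over the remaining indices does not involve [g i], so it is measurable for the other
   vectors and factors out of the inner integral. *)
pose Phi w := (\prod_(j <- s) F j w w)%R.
have Phi0 w : (0 <= Phi w)%R by exact: prodr_ge0.
have mPhiA : measurable_fun [set: others_type i] Phi.
  apply: measurable_prod => j js; apply: mFd; rewrite ?inE ?eqxx ?js ?orbT//.
  by apply: contraNneq nis => <-.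
have mPhi : measurable_fun [set: T] Phi.
  exact: measurableT_comp mPhiA (@measurable_id_others i).
have c0 : (0 <= c)%R.
  rewrite -lee_fin (le_trans _ (intF i point _)) ?mem_head//.
  by apply: integral_ge0 => w _; rewrite lee_fin.
have mFi w : measurable_fun [set: T] (F i w).
  have h : measurable_fun [set: self_type i] (F i w).
    exact: (@measurable_fun_pair2 _ _ _ (others_type i) (self_type i) _
      (fun z => F i z.1 z.2) w (mF i (mem_head _ _))).
  exact: measurableT_comp h (@measurable_id_self i).
pose G (z : others_type i * self_type i) := (F i z.1 z.2 * Phi z.1)%:E.
have mG : measurable_fun setT G.
  apply/measurable_EFinP/measurable_funM; first exact: mF (mem_head _ _).
  exact: measurableT_comp.
have -> : \int[P]_w (\prod_(j <- i :: s) F j w w)%:E =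
    \int[P]_w \int[P]_w' G (w, w').
  under eq_integral do rewrite big_cons.
  rewrite -(@independent_pair_integral _ _ _ _ _ _ _ P
    (id : T -> others_type i) (id : T -> self_type i)) //.
  - exact: measurable_id_others.
  - exact: measurable_id_self.
  - exact: others_indep.
  - by move=> z; rewrite lee_fin mulr_ge0.
rewrite exprS EFinM (le_trans (y := \int[P]_w (c%:E * (Phi w)%:E)))//.
  apply: ge0_le_integral => //.
  - by move=> w _; apply: integral_ge0 => w' _; rewrite lee_fin mulr_ge0.
  - apply: (@measurable_partial_integral _ _ _ _ _ _ _ P
      (id : T -> others_type i) (id : T -> self_type i)) => //.
    + exact: measurable_id_others.
    + exact: measurable_id_self.
    + by move=> z; rewrite lee_fin mulr_ge0.
  - exact/measurable_EFinP/measurable_funM.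
  - move=> w _; rewrite /G /=; under eq_integral do rewrite mulrC EFinM.
    rewrite ge0_integralZl_EFin//;
      [|by move=> w' _; rewrite lee_fin|exact/measurable_EFinP].
    by rewrite muleC lee_wpmul2r ?lee_fin // intF ?mem_head.
rewrite ge0_integralZl_EFin//; last 2 first.
- by move=> w _; rewrite lee_fin.
- exact/measurable_EFinP.
rewrite lee_pmul//.
- by apply: integral_ge0 => w _; rewrite lee_fin.
- apply: IHs => //.
  + by move=> j js; apply: mF; rewrite inE js orbT.
  + by move=> j k js ks; apply: mFd; rewrite inE ?js ?ks orbT.
  + by move=> j w js; apply: intF; rewrite inE js orbT.
Qed.

End IndependentVectors.

(** * Sub-Gaussian vectors *)

Section Vectors.
Context {R : realType} {d : nat}.
Implicit Types (x y z : 'rV[R]_d) (a : R).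

Lemma dotvC x y : dotv x y = dotv y x.
Proof. by apply: eq_bigr => l _; rewrite mulrC. Qed.

Lemma dotvDl x y z : dotv (x + y) z = dotv x z + dotv y z.
Proof. by rewrite -big_split; apply: eq_bigr => l _; rewrite mxE mulrDl. Qed.

Lemma dotvZl a x y : dotv (a *: x) y = a * dotv x y.
Proof. by rewrite mulr_sumr; apply: eq_bigr => l _; rewrite mxE mulrA. Qed.

Lemma dotvNl x y : dotv (- x) y = - dotv x y.
Proof. by rewrite -scaleN1r dotvZl mulN1r. Qed.

Lemma dotvBl x y z : dotv (x - y) z = dotv x z - dotv y z.
Proof. by rewrite dotvDl dotvNl. Qed.

Lemma dotvDr x y z : dotv x (y + z) = dotv x y + dotv x z.
Proof. by rewrite dotvC dotvDl !(dotvC x). Qed.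

Lemma dotvZr a x y : dotv x (a *: y) = a * dotv x y.
Proof. by rewrite dotvC dotvZl dotvC. Qed.

Lemma dotvBr x y z : dotv x (y - z) = dotv x y - dotv x z.
Proof. by rewrite dotvC dotvBl !(dotvC x). Qed.

Lemma dotv0l y : dotv 0 y = 0.
Proof. by rewrite -(scale0r 0) dotvZl mul0r. Qed.

Lemma dotv_suml (I : Type) (r : seq I) (p : pred I) (F : I -> 'rV[R]_d) y :
  dotv (\sum_(i <- r | p i) F i) y = \sum_(i <- r | p i) dotv (F i) y.
Proof.
elim/big_rec2 : _ => [|i b1 b2 _ <-]; first exact: dotv0l.
by rewrite dotvDl.
Qed.

Lemma dotv_sumr (I : Type) (r : seq I) (p : pred I) (F : I -> 'rV[R]_d) y :
  dotv y (\sum_(i <- r | p i) F i) = \sum_(i <- r | p i) dotv y (F i).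
Proof. by rewrite dotvC dotv_suml; apply: eq_bigr => i _; rewrite dotvC. Qed.

Lemma sqnormE x : sqnorm x = dotv x x.
Proof. by apply: eq_bigr => l _; rewrite expr2. Qed.

Lemma sqnorm_ge0 x : 0 <= sqnorm x.
Proof. by apply: sumr_ge0 => l _; rewrite sqr_ge0. Qed.

Lemma sqnormZ a x : sqnorm (a *: x) = a ^+ 2 * sqnorm x.
Proof. by rewrite !sqnormE dotvZl dotvZr expr2 mulrA. Qed.

Lemma sqnormD x y : sqnorm (x + y) = sqnorm x + 2 * dotv x y + sqnorm y.
Proof. rewrite !sqnormE !dotvDl !dotvDr (dotvC y x); ring. Qed.

Lemma sqnormB x y : sqnorm (x - y) = sqnorm x - 2 * dotv x y + sqnorm y.
Proof. rewrite !sqnormE !dotvBl !dotvBr (dotvC y x); ring. Qed.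

Lemma sqr_enorm x : enorm x ^+ 2 = sqnorm x.
Proof. by rewrite /enorm sqr_sqrtr // sqnorm_ge0. Qed.

Lemma enorm_ge0 x : 0 <= enorm x.
Proof. exact: sqrtr_ge0. Qed.

Lemma sqnorm_eq0 x : (sqnorm x == 0) = (x == 0).
Proof.
apply/eqP/eqP => [/eqP|->]; last by rewrite sqnormE dotv0l.
rewrite psumr_eq0 => [/allP x0|l _]; last exact: sqr_ge0.
apply/rowP => l; rewrite mxE; apply/eqP.
by have := x0 l (mem_index_enum _); rewrite sqrf_eq0.
Qed.

Lemma dotv_sqr_le x y : dotv x y ^+ 2 <= sqnorm x * sqnorm y.
Proof.
have [->|y0] := eqVneq y 0.
  by rewrite dotvC dotv0l expr0n mulr_ge0 ?sqnorm_ge0.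
have ny : 0 < sqnorm y by rewrite lt_def sqnorm_eq0 y0 sqnorm_ge0.
have := sqnorm_ge0 (sqnorm y *: x - dotv x y *: y).
rewrite sqnormB !sqnormZ dotvZl dotvZr => h.
rewrite -(ler_pM2l ny); nra.
Qed.

Lemma dotv_le x y c : 0 < c ->
  2 * dotv x y <= c * sqnorm x + c^-1 * sqnorm y.
Proof.
move=> c0; have := sqnorm_ge0 (c *: x - y).
rewrite sqnormB sqnormZ dotvZl => h.
by rewrite -(ler_pM2l c0) mulrDr [c * (c^-1 * _)]mulrA divff ?gt_eqF//; nra.
Qed.

End Vectors.

Section SubGaussian.
Local Open Scope ereal_scope.
Context {R : realType} {dT : measure_display} {T : measurableType dT}.
Variables (P : probability T R) (d : nat) (g : T -> 'rV[R]_d) (tau : R).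
Hypothesis mg : forall j, measurable_fun setT (fun w => g w ord0 j).
Hypothesis tau0 : (0 < tau)%R.
Hypothesis subg : subg_norm P g <= tau%:E.

Lemma measurable_dotv v : measurable_fun setT (fun w => dotv (g w) v).
Proof.
by apply: measurable_sum => l; apply: measurable_funM => //; exact: mg.
Qed.

(** The factor 2 in [2 * tau] gives a strict inequality, so some admissible [t] below [2 * tau]
    exists without the infimum being attained. The radius [r] may exceed the norm of [v], which also
    covers [v = 0]. *)
Lemma subg_exp_moment v r : (0 < r)%R -> (sqnorm v <= r ^+ 2)%R ->
  \int[P]_w (expR (dotv (g w) v ^+ 2 / ((2 * tau) ^+ 2 * r ^+ 2)))%:E <= 2%:E.
Proof.
move=> r0 vr.
have [v0|v0] := eqVneq v 0%R.
  rewrite (eq_integral (cst 1%:E)); last first.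
    by move=> w _; rewrite v0 dotvC dotv0l expr0n /= mul0r expR0.
  rewrite integral_cst// mul1e [X in X <= _](probability_setT P).
  by rewrite lee_fin ler1n.
have ev0 : (0 < enorm v)%R.
  by rewrite lt_def enorm_ge0 andbT -sqrf_eq0 sqr_enorm sqnorm_eq0.
pose u : 'rV[R]_d := ((enorm v)^-1 *: v)%R.
have u1 : enorm u = 1%R.
  by rewrite /enorm sqnormZ -sqr_enorm -exprMn mulVf ?gt_eqF// expr1n sqrtr1.
have : psi2_norm P (fun w => dotv (g w) u) < (2 * tau)%:E.
  apply: (@le_lt_trans _ _ tau%:E); last by rewrite lte_fin ltr_pMl ?ltr1n.
  by apply: le_trans subg; apply: ereal_sup_ubound; exists u => //.
case/ereal_inf_lt => _ [t [t0 It] <-]; rewrite lte_fin => tt.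
apply: le_trans It; apply: ge0_le_integral => //.
- apply/measurable_EFinP; apply: measurableT_comp => //.
  by apply: measurable_funM => //; apply: measurable_funX; exact: measurable_dotv.
- apply/measurable_EFinP; apply: measurableT_comp => //.
  by apply: measurable_funM => //; apply: measurable_funX; exact: measurable_dotv.
- move=> w _; rewrite lee_fin ler_expR.
  have -> : (dotv (g w) u ^+ 2 = dotv (g w) v ^+ 2 / sqnorm v)%R.
    by rewrite /u dotvZr exprMn exprVn sqr_enorm mulrC.
  have nv0 : (0 < sqnorm v)%R by rewrite -sqr_enorm exprn_gt0.
  rewrite -mulrA ler_wpM2l ?sqr_ge0//.
  rewrite -invfM lef_pV2 ?posrE ?mulr_gt0 ?exprn_gt0 ?mulr_gt0//.
  rewrite mulrC ler_pM ?sqr_ge0 ?sqnorm_ge0// ler_sqr ?nnegrE ?ltW//.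
  by rewrite mulr_gt0.
Qed.

End SubGaussian.

(** * Spectral bound on the noise *)

Section LatticeRounding.
Context {R : realType} {d : nat}.
Implicit Types (v z : 'rV[R]_d).

(* A convex function on a segment is at most its maximum at the two ends, so
   the coordinates of v can be rounded one at a time without decreasing q. *)
Lemma lattice_rounding (n : nat) (a : 'I_n -> 'rV[R]_d) v :
  exists z, [/\ forall l, `|z 0 l - v 0 l| <= 1,
    forall l, z 0 l \is a Num.int &
    \sum_i dotv (a i) v ^+ 2 <= \sum_i dotv (a i) z ^+ 2].
Proof.
suff : forall s : seq 'I_d, uniq s -> exists z,
    [/\ forall l, `|z 0 l - v 0 l| <= 1, forall l, l \in s -> z 0 l \is a Num.int,
        forall l, l \notin s -> z 0 l = v 0 l &
        \sum_i dotv (a i) v ^+ 2 <= \sum_i dotv (a i) z ^+ 2].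
  case/(_ (enum 'I_d) (enum_uniq _)) => z [z1 zi _ zq].
  by exists z; split => // l; apply: zi; rewrite mem_enum.
elim=> [_|l s IHs /= /andP[ls us]].
  by exists v; split => // l; rewrite subrr normr0.
have [z [z1 zi zv zq]] := IHs us.
pose f : R := (Num.floor (v 0 l))%:~R.
have f0 : f <= v 0 l by exact: floor_le.
have f1 : v 0 l <= f + 1 by rewrite ltW // /f -intrD1 floorD1_gt.
pose e : 'rV[R]_d := delta_mx 0 l.
pose zz (c : R) := z + (c - v 0 l) *: e.
have zzE c l' : zz c 0 l' = if l' == l then c else z 0 l'.
  rewrite !mxE /=; case: eqP => [->|_]; last by rewrite mulr0 addr0.
  by rewrite zv // mulr1 addrC subrK.
have step c : c \is a Num.int -> `|c - v 0 l| <= 1 ->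
    \sum_i dotv (a i) z ^+ 2 <= \sum_i dotv (a i) (zz c) ^+ 2 ->
    exists z, [/\ forall l, `|z 0 l - v 0 l| <= 1,
        forall l', l' \in l :: s -> z 0 l' \is a Num.int,
        forall l', l' \notin l :: s -> z 0 l' = v 0 l' &
        \sum_i dotv (a i) v ^+ 2 <= \sum_i dotv (a i) z ^+ 2].
  move=> ci c1 cq; exists (zz c); split.
  - by move=> l'; rewrite zzE; case: eqP => [->|].
  - by move=> l'; rewrite zzE inE; case: eqP => //= _; exact: zi.
  - by move=> l'; rewrite zzE inE negb_or; case: eqP => //= _; exact: zv.
  - exact: le_trans zq cq.
have fint : f \is a Num.int by exact: intr_int.
pose A := \sum_i dotv (a i) z ^+ 2.
pose B := \sum_i dotv (a i) z * dotv (a i) e.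
pose C := \sum_i dotv (a i) e ^+ 2.
have C0 : 0 <= C by apply: sumr_ge0 => i _; exact: sqr_ge0.
have qE c : \sum_i dotv (a i) (zz c) ^+ 2 =
    A + 2 * (c - v 0 l) * B + (c - v 0 l) ^+ 2 * C.
  rewrite /A /B /C !mulr_sumr -!big_split /=.
  by apply: eq_bigr => i _; rewrite dotvDr dotvZr; ring.
case: (lerP A (\sum_i dotv (a i) (zz f) ^+ 2)) => hf.
  by apply: (step f fint) => //; rewrite ler_norml; apply/andP; split; lra.
apply: (step (f + 1)).
- by apply: rpredD => //; exact: int_num1.
- by rewrite ler_norml; apply/andP; split; lra.
(* Moving left to [f] lowered a quadratic with leading coefficient [C >= 0], so its slope [B] at the
   current point is nonnegative and moving right to [f + 1] cannot lower it. *)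
- rewrite -/A; move: hf; rewrite !qE => hf.
  set t := v 0 l - f.
  have t0 : 0 <= t by rewrite /t; lra.
  have t1 : t <= 1 by rewrite /t; lra.
  have -> : f + 1 - v 0 l = 1 - t by rewrite /t; ring.
  have ft : f - v 0 l = - t by rewrite /t opprB.
  have B0 : 0 <= B.
    rewrite leNgt; apply/negP => B0; move: hf; rewrite ft ltNge => /negP; apply.
    have := sqr_ge0 t; have : 0 <= t * - B by rewrite mulr_ge0// oppr_ge0 ltW.
    nra.
  rewrite -addrA lerDl addr_ge0// mulr_ge0 ?sqr_ge0//.
  by rewrite mulr_ge0// subr_ge0.
Qed.

End LatticeRounding.

Section LatticeCount.
Context {R : realType}.

Lemma expRN_le_half (m : nat) : expR (- m%:R) <= 2^-1 ^+ m :> R.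
Proof.
rewrite -[m%:R]mulr1 -mulrN mulrC expRM_natr expRN lerXn2r ?nnegrE ?invr_ge0 ?expR_ge0//.
by rewrite lef_pV2 ?posrE ?expR_gt0// (le_trans _ (expR_ge1Dx 1)).
Qed.

(** Index [j] stands for the integer [j - K]. The induction carries the bound [3 - 2 * 2^-1 ^+ K]:
    the two new end terms are at most [2^-1 ^+ K.+1] each, together exactly what the bound gains. *)
Lemma sum_expR_sqr (K : nat) :
  \sum_(j < K.*2.+1) expR (- (j%:R - K%:R) ^+ 2) <= 3 :> R.
Proof.
suff : \sum_(j < K.*2.+1) expR (- (j%:R - K%:R) ^+ 2) <= 3 - 2 * 2^-1 ^+ K :> R.
  move/le_trans; apply; rewrite gerBl mulr_ge0// exprn_ge0//.
elim: K => [|K IHK].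
  by rewrite big_ord1 subrr expr0n oppr0 expR0 expr0 mulr1; lra.
rewrite doubleS big_ord_recl big_ord_recr /=.
have tail : expR (- (K.+1%:R) ^+ 2) <= 2^-1 ^+ K.+1 :> R.
  apply: le_trans (expRN_le_half _); rewrite ler_expR lerN2 expr2.
  by rewrite ler_peMl// ler1n.
have -> : expR (- (0%:R - K.+1%:R) ^+ 2) = expR (- (K.+1%:R) ^+ 2) :> R.
  by rewrite sub0r sqrrN.
have -> : expR (- ((lift ord0 (@ord_max K.*2.+1))%:R - K.+1%:R) ^+ 2)
    = expR (- (K.+1%:R) ^+ 2) :> R.
  congr (expR (- _ ^+ 2)); rewrite lift0 /= -addnn -!natr1 natrD; ring.
under eq_bigr => j _.
  have -> : (lift ord0 (widen_ord (leqnSn K.*2.+1) j))%:R - K.+1%:R = j%:R - K%:R :> R.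
    by rewrite lift0 /= -!natr1; ring.
  over.
move: tail; rewrite (exprS 2^-1 K) => tail; lra.
Qed.

(** The integer points of the box of half-width [K], shifted by [K] so that they are indexed by a
    finite type. *)
Definition lattice_pt (d K : nat) (f : {ffun 'I_d -> 'I_K.*2.+1}) : 'rV[R]_d :=
  \row_l ((f l)%:R - K%:R).

(** The Gaussian weight factors over coordinates. The total is exponential in [d] uniformly in [K],
    which takes the place of counting lattice points in a ball. *)
Lemma sum_expR_lattice (d K : nat) :
  \sum_(f : {ffun 'I_d -> 'I_K.*2.+1}) expR (- sqnorm (lattice_pt f)) <= 3 ^+ d :> R.
Proof.
under eq_bigr => f _.
  rewrite /sqnorm -sumrN expR_sum.
  under eq_bigr do rewrite mxE.
  over.
rewrite -(bigA_distr_bigA (fun (_ : 'I_d) (j : 'I_K.*2.+1) => expR (- (j%:R - K%:R) ^+ 2))).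
rewrite prodr_const card_ord lerXn2r ?nnegrE ?sum_expR_sqr//.
by apply: sumr_ge0 => j _; exact: expR_ge0.
Qed.

Lemma lattice_ptP (d K : nat) (z : 'rV[R]_d) :
  (forall l, z 0 l \is a Num.int) -> (forall l, `|z 0 l| <= K%:R) ->
  exists f : {ffun 'I_d -> 'I_K.*2.+1}, z = lattice_pt f.
Proof.
move=> zi zK.
have h l : exists j : 'I_K.*2.+1, z 0 l = j%:R - K%:R.
  have /andP[z1 z2] : - K%:R <= z 0 l <= K%:R by rewrite -ler_norml.
  have /natrP[m hm] : z 0 l + K%:R \is a Num.nat.
    by rewrite natrEint rpredD ?natr_int ?zi//=; lra.
  have mK : (m < K.*2.+1)%N.
    by rewrite ltnS -(ler_nat R) -hm -addnn natrD; lra.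
  by exists (Ordinal mK); rewrite /= -hm addrK.
have [f hf] := choice h.
by exists [ffun l => f l]; apply/rowP => l; rewrite mxE ffunE -hf.
Qed.

End LatticeCount.

Section Markov.
Local Open Scope ereal_scope.
Context {R : realType} {dT : measure_display} {T : measurableType dT}.
Variables (P : probability T R).

Lemma markov_ge (f : T -> R) (c a : R) : measurable_fun setT f ->
  (forall w, 0 <= f w)%R -> (0 < a)%R -> \int[P]_w (f w)%:E <= c%:E ->
  P [set w | a <= f w]%R <= (c / a)%:E.
Proof.
move=> mf f0 a0 fc; pose fR := HB.pack_for {RV P >-> R} f
  (isMeasurableFun.Build _ _ _ _ f mf).
have := @markov _ T R P fR id a a0 (@measurable_id _ _ setT) (fun r h => h)
  (fun x y _ _ h => h).
have -> : [set x | a%:E <= `|(fR x)%:E|] = [set w | a <= f w]%R.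
  by apply/seteqP; split=> w /=; rewrite lee_fin ger0_norm.
rewrite unlock /comp /=.
under eq_integral do rewrite ger0_norm//.
move=> /le_trans/(_ fc); rewrite muleC -lee_pdivlMr//.
Qed.
End Markov.

Section SpectralBound.
Local Open Scope ereal_scope.
Context {R : realType} {dT : measure_display} {T : measurableType dT}.
Variables (P : probability T R) (n d : nat) (g : 'I_n -> T -> 'rV[R]_d).
Variable (tau : R).
Hypothesis mg : forall i j, measurable_fun setT (fun w => g i w ord0 j).
Hypothesis indep : indep_rvecs P g.
Hypothesis tau0 : (0 < tau)%R.
Hypothesis subg : forall i, subg_norm P (g i) <= tau%:E.

(** The exponential is a product whose factor [i] depends on [g i] alone and has mean at most 2. *)
Lemma exp_moment_sum_sqr v r : (0 < r)%R -> (sqnorm v <= r ^+ 2)%R ->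
  \int[P]_w (expR (\sum_i dotv (g i w) v ^+ 2 / ((2 * tau) ^+ 2 * r ^+ 2)))%:E
    <= (2 ^+ n)%:E.
Proof.
move=> r0 vr.
pose F (i : 'I_n) (w w' : T) : R :=
  expR (dotv (g i w') v ^+ 2 / ((2 * tau) ^+ 2 * r ^+ 2)).
have mF d' (T' : measurableType d') (i : 'I_n) (X : T' -> T) :
    (forall l, measurable_fun [set: T'] (fun w => g i (X w) ord0 l)) ->
    measurable_fun [set: T'] (fun w => F i (X w) (X w)).
  move=> mX; rewrite /F; apply: measurableT_comp => //.
  apply: measurable_funM => //; apply: measurable_funX.
  by apply: measurable_sum => l; exact: measurable_funM.
rewrite (eq_integral (fun w => (\prod_(i <- enum 'I_n) F i w w)%:E)); last first.
  by move=> w _; rewrite big_enum expR_sum.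
rewrite -[in X in _ <= X](size_enum_ord n).
apply: (le_integral_prod mg indep).
- exact: enum_uniq.
- by move=> i w w'; exact: expR_ge0.
- move=> i _; apply: (mF _ _ i (fun z : others_type g i * self_type g i => z.2)) => l.
  exact: measurableT_comp (@measurable_coord_self _ _ _ _ _ g i l) measurable_snd.
- move=> i j _ _ ji; apply: (mF _ (others_type g i) j id) => l.
  exact: measurable_coord_others.
- by move=> i w _; exact: subg_exp_moment.
Qed.

(* Markov's inequality for this single variable replaces a union bound over the
   net. *)
Definition lattice_mgf (w : T) : R :=
  (\sum_(f : {ffun 'I_d -> 'I_d.+1.*2.+1} | sqnorm (lattice_pt f : 'rV[R]_d) <= 4 * d%:R)
    expR (- sqnorm (lattice_pt f : 'rV[R]_d)) *
    expR (\sum_i dotv (g i w) (lattice_pt f) ^+ 2 / ((2 * tau) ^+ 2 * (4 * d%:R))))%R.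

Lemma measurable_lattice_mgf : measurable_fun setT lattice_mgf.
Proof.
rewrite /lattice_mgf; under eq_fun do rewrite -big_filter.
apply: measurable_sum => f.
apply: measurable_funM => //; apply: measurableT_comp => //.
apply: measurable_sum => i; apply: measurable_funM => //.
apply: measurable_funX; apply: measurable_sum => l.
by apply: measurable_funM => //; exact: mg.
Qed.

Lemma lattice_mgf_ge0 w : (0 <= lattice_mgf w)%R.
Proof. by apply: sumr_ge0 => f _; rewrite mulr_ge0 ?expR_ge0. Qed.

Lemma integral_lattice_mgf : (0 < d)%N ->
  \int[P]_w (lattice_mgf w)%:E <= (3 ^+ d * 2 ^+ n)%:E.
Proof.
move=> d0; rewrite /lattice_mgf.
under eq_integral do rewrite -big_filter -sumEFin.
rewrite ge0_integral_sum//; last first.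
- move=> f; apply/measurable_EFinP.
  apply: measurable_funM => //; apply: measurableT_comp => //.
  apply: measurable_sum => i; apply: measurable_funM => //.
  apply: measurable_funX; apply: measurable_sum => l.
  by apply: measurable_funM => //; exact: mg.
rewrite big_filter; apply: (@le_trans _ _ (\sum_(f : {ffun 'I_d -> 'I_d.+1.*2.+1} |
    (sqnorm (lattice_pt f : 'rV[R]_d) <= 4 * d%:R)%R)
    (expR (- sqnorm (lattice_pt f : 'rV[R]_d)) * 2 ^+ n)%:E)).
  apply: lee_sum => f fd.
  under eq_integral do rewrite EFinM.
  rewrite ge0_integralZl_EFin ?expR_ge0//; last first.
  - apply/measurable_EFinP; apply: measurableT_comp => //.
    apply: measurable_sum => i; apply: measurable_funM => //.
    apply: measurable_funX; apply: measurable_sum => l.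
    by apply: measurable_funM => //; exact: mg.
  rewrite EFinM lee_wpmul2l ?lee_fin ?expR_ge0//.
  have d4 : (0 <= 4 * d%:R :> R)%R by rewrite mulr_ge0.
  rewrite -[X in (_ * X)%R](sqr_sqrtr d4).
  apply: exp_moment_sum_sqr; last by rewrite sqr_sqrtr.
  by rewrite sqrtr_gt0 mulr_gt0 ?ltr0n.
rewrite sumEFin lee_fin -mulr_suml ler_wpM2r ?exprn_ge0//.
apply: le_trans (sum_expR_lattice d d.+1).
rewrite [leRHS](bigID (fun f => sqnorm (lattice_pt f : 'rV[R]_d) <= 4 * d%:R)%R) /=.
by rewrite lerDl sumr_ge0// => f _; exact: expR_ge0.
Qed.

Local Open Scope ring_scope.

(** By homogeneity take [sqnorm v = d]. Rounding moves each coordinate by at most 1, so the lattice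
    point has squared norm at most [4 * d] and lies in the box of half-width [d + 1]: it indexes a
    term of [lattice_mgf], and that term is at most the whole sum. *)
Lemma lattice_mgf_spectral w : (0 < d)%N ->
  lattice_mgf w <= expR (2 * (n + d)%:R) ->
  forall v, \sum_i dotv (g i w) v ^+ 2 <= 96 * tau ^+ 2 * (n + d)%:R * sqnorm v.
Proof.
move=> d0 Zw v.
have d0R : 0 < d%:R :> R by rewrite ltr0n.
have key u : sqnorm u <= d%:R -> \sum_i dotv (g i w) u ^+ 2 <=
    96 * tau ^+ 2 * (n + d)%:R * d%:R.
  move=> ud; have [z [z1 zi zq]] := lattice_rounding (fun i => g i w) u.
  apply: le_trans zq _.
  have zle l : z 0 l ^+ 2 <= 2 * u 0 l ^+ 2 + 2.
    have := z1 l; rewrite ler_norml => /andP[h1 h2].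
    have : (z 0 l - u 0 l) ^+ 2 <= 1 by rewrite -real_normK ?num_real// expr_le1.
    have := sqr_ge0 (z 0 l - 2 * u 0 l); nra.
  have zd : sqnorm z <= 4 * d%:R.
    apply: (@le_trans _ _ (\sum_(l < d) (2 * u 0 l ^+ 2 + 2))); first exact: ler_sum.
    rewrite big_split /= -mulr_sumr sumr_const card_ord -mulr_natr.
    move: ud; rewrite /sqnorm; lra.
  have zK l : `|z 0 l| <= d.+1%:R.
    have : u 0 l ^+ 2 <= d%:R ^+ 2.
      apply: (@le_trans _ _ d%:R); last first.
        by rewrite expr2 ler_peMl// ler1n.
      apply: le_trans ud; rewrite /sqnorm (bigD1 l)//= lerDl.
      by apply: sumr_ge0 => *; exact: sqr_ge0.
    rewrite -real_normK ?num_real// ler_sqr ?nnegrE// => ul.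
    rewrite -[z 0 l](subrK (u 0 l)) (le_trans (ler_normD _ _))//.
    by rewrite -natr1 addrC lerD.
  have [f fz] := lattice_ptP zi zK.
  move: zd; rewrite fz => fd.
  have : expR (- sqnorm (lattice_pt f : 'rV[R]_d)) *
    expR (\sum_i dotv (g i w) (lattice_pt f) ^+ 2 / ((2 * tau) ^+ 2 * (4 * d%:R))) <=
    expR (2 * (n + d)%:R).
    apply: le_trans Zw; rewrite /lattice_mgf (bigD1 f)//= lerDl.
    by apply: sumr_ge0 => *; rewrite mulr_ge0 ?expR_ge0.
  rewrite -expRD ler_expR -mulr_suml addrC lerBlDr ler_pdivrMr; last first.
    by rewrite !mulr_gt0// exprn_gt0// mulr_gt0.
  move=> /le_trans; apply.
  (* Multiplying [6 * (n + d)] by the scale [(2 * tau) ^+ 2 * (4 * d)] produces the constant 96. *)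
  have : (2 * (n + d)%:R + sqnorm (lattice_pt f : 'rV[R]_d)) <= 6 * (n + d)%:R.
    by rewrite natrD; move: fd; have : 0 <= n%:R :> R by []; lra.
  move=> /(ler_wpM2r (_ : 0 <= (2 * tau) ^+ 2 * (4 * d%:R))) /le_trans; apply.
    by rewrite mulr_ge0 ?sqr_ge0// mulr_ge0.
  lra.
have [->|v0] := eqVneq v 0.
  rewrite big1 ?sqnormE ?dotv0l ?mulr0// => i _.
  by rewrite dotvC dotv0l expr0n.
have sv0 : 0 < sqnorm v by rewrite lt_def sqnorm_eq0 v0 sqnorm_ge0.
pose c := Num.sqrt (d%:R / sqnorm v).
have c2 : c ^+ 2 = d%:R / sqnorm v by rewrite sqr_sqrtr// divr_ge0// ltW.
have := key (c *: v); rewrite sqnormZ c2 divfK ?gt_eqF// => /(_ (lexx _)).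
under eq_bigr do rewrite dotvZr exprMn c2.
rewrite -mulr_sumr mulrAC ler_pdivrMr// mulrC => h.
rewrite -(ler_pM2r d0R); apply: le_trans h _.
lra.
Qed.

(** Markov's inequality with mean at most [3 ^+ d * 2 ^+ n]. As 3 is at most [expR 2] and 2 at most
    [expR 1], the threshold leaves a factor [expR (- n)]. *)
Lemma spectral_event : (0 < d)%N ->
  (P [set w | expR (2 * (n + d)%:R) <= lattice_mgf w]%R <= (expR (- n%:R))%:E)%E.
Proof.
move=> d0; apply: le_trans (markov_ge measurable_lattice_mgf lattice_mgf_ge0
  (expR_gt0 _) (integral_lattice_mgf d0)) _.
rewrite lee_fin ler_pdivrMr ?expR_gt0// -expRD.
have e2 : 2 <= expR 1 :> R by exact: le_trans (expR_ge1Dx 1).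
have -> : - n%:R + 2 * (n + d)%:R = 2 * d%:R + n%:R :> R by rewrite natrD; ring.
rewrite expRD ler_pM ?exprn_ge0//.
- rewrite expRM_natr lerXn2r ?nnegrE ?expR_ge0//.
  by rewrite -[2]/(1+1)%R expRD; nra.
- by rewrite -[n%:R]mul1r expRM_natr lerXn2r ?nnegrE ?expR_ge0.
Qed.

End SpectralBound.
(** The inverse is written as [x * (x ^+ 2)^-1], so that the power function is applied to a
    nonnegative base; both sides vanish at 0. *)
Lemma measurable_fun_inv (R : realType) (d : measure_display)
    (T : measurableType d) (D : set T) (f : T -> R) :
  measurable_fun D f -> measurable_fun D (fun x => (f x)^-1).
Proof.
move=> mf.
have -> : (fun x => (f x)^-1) = (fun x => f x * (f x ^+ 2) `^ (-1)).
  apply/funext => x; rewrite powR_inv1 ?sqr_ge0//.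
  by have [->|fx0] := eqVneq (f x) 0; rewrite ?invr0 ?mul0r//; field.
apply: measurable_funM => //.
have mp : measurable_fun [set: R] (fun y : R => y `^ (-1)) by exact: measurable_powR.
have mf2 : measurable_fun D (fun x => f x ^+ 2) by exact: measurable_funX.
exact: (measurableT_comp mp mf2).
Qed.

(** * Exponential moment of the noise tested against decoupled vectors *)

Section DecoupledMgf.
Local Open Scope ereal_scope.
Context {R : realType} {dT : measure_display} {T : measurableType dT}.
Variables (P : probability T R) (n d k : nat) (g : 'I_n -> T -> 'rV[R]_d).
Variable (tau : R).
Hypothesis mg : forall i j, measurable_fun setT (fun w => g i w ord0 j).
Hypothesis indep : indep_rvecs P g.
Hypothesis tau0 : (0 < tau)%R.
Hypothesis subg : forall i, subg_norm P (g i) <= tau%:E.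

Variables (J : {set 'I_n}) (V : 'I_n -> 'I_k -> T -> 'rV[R]_d).
Variables (p : 'I_n -> pred 'I_k) (S : 'I_n -> 'I_k -> R) (delta : R).
Hypothesis delta0 : (0 <= delta)%R.
Hypothesis S0 : forall i b, p i b -> (0 < S i b)%R.
Hypothesis mV : forall i, i \notin J -> forall i' b l,
  measurable_fun [set: others_type g i] (fun w => V i' b w ord0 l).

(* The maximum keeps the exponential moment given V at most 2 for every value of
   V; on the event of interest it equals S. *)
Definition decoupled_factor (i : 'I_n) (w w' : T) : R :=
  (1 + delta / k%:R * \sum_(b | p i b) expR (dotv (g i w') (V i b w) ^+ 2 /
    ((2 * tau) ^+ 2 * Num.max (S i b) (sqnorm (V i b w)))))%R.

Lemma decoupled_factor_ge1 i w w' : (1 <= decoupled_factor i w w')%R.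
Proof.
rewrite lerDl mulr_ge0 ?divr_ge0// sumr_ge0// => b _; exact: expR_ge0.
Qed.

Lemma measurable_decoupled_factor dX (TX : measurableType dX) i (X Y : TX -> T) :
  (forall b l, measurable_fun [set: TX] (fun w => V i b (X w) ord0 l)) ->
  (forall l, measurable_fun [set: TX] (fun w => g i (Y w) ord0 l)) ->
  measurable_fun [set: TX] (fun w => decoupled_factor i (X w) (Y w)).
Proof.
move=> mVX mgY; apply: measurable_funD => //; apply: measurable_funM => //.
under eq_fun do rewrite -big_filter.
apply: measurable_sum => b; apply: measurableT_comp => //.
apply: measurable_funM.
  apply: measurable_funX; apply: measurable_sum => l.
  exact: measurable_funM.
apply: measurable_fun_inv; apply: measurable_funM => //.
apply: measurable_maxr => //.
by apply: measurable_sum => l; exact: measurable_funX.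
Qed.

(** For [i] outside [J] the vectors [V] are functions of the noise other than [g i]. Given them,
    each of the at most [k] exponentials has mean at most 2, so integrating out [g i] costs a factor
    [1 + 2 * delta]. *)
Lemma decoupled_mgf : \int[P]_w
    (\prod_(i | i \notin J) decoupled_factor i w w)%:E <=
  ((1 + 2 * delta) ^+ n)%:E.
Proof.
rewrite (eq_integral (fun w =>
    (\prod_(i <- enum [predC J]) decoupled_factor i w w)%:E)); last first.
  by move=> w _; rewrite big_enum.
apply: (@le_trans _ _ ((1 + 2 * delta) ^+ size (enum [predC J]))%:E); last first.
  rewrite lee_fin ler_weXn2l//; first by rewrite lerDl mulr_ge0.
  by rewrite -cardE -[leqRHS](card_ord n) max_card.
apply: (le_integral_prod mg indep).
- exact: enum_uniq.
- by move=> i w w'; exact: le_trans (decoupled_factor_ge1 i w w').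
- move=> i; rewrite mem_enum => iJ.
  apply: (@measurable_decoupled_factor _ (others_type g i * self_type g i)%type i fst snd).
  + move=> b l.
    exact: measurableT_comp (mV iJ i b l) measurable_fst.
  + move=> l.
    exact: measurableT_comp (@measurable_coord_self _ _ _ _ _ g i l) measurable_snd.
- move=> i j; rewrite !mem_enum => iJ jJ ji.
  apply: (@measurable_decoupled_factor _ (others_type g i) j id id).
  + by move=> b l; exact: mV.
  + by move=> l; exact: measurable_coord_others.
- move=> i w _; rewrite /decoupled_factor.
  have mE b : measurable_fun [set: T] (fun w' => expR (dotv (g i w') (V i b w) ^+ 2 /
      ((2 * tau) ^+ 2 * Num.max (S i b) (sqnorm (V i b w))))).
    apply: measurableT_comp => //; apply: measurable_funM => //.
    by apply: measurable_funX; exact: measurable_dotv.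
  under eq_integral do rewrite EFinD EFinM.
  rewrite ge0_integralD//; last 2 first.
  + by move=> w' _; rewrite -EFinM lee_fin mulr_ge0 ?divr_ge0// sumr_ge0//
      => b _; exact: expR_ge0.
  + apply/measurable_EFinP; apply: measurable_funM => //.
    by under eq_fun do rewrite -big_filter; exact: measurable_sum.
  rewrite integral_cst// mul1e [X in X + _](probability_setT P) EFinD leeD2l//.
  rewrite ge0_integralZl_EFin ?divr_ge0//; last 2 first.
  + by move=> w' _; rewrite lee_fin sumr_ge0// => b _; exact: expR_ge0.
  + apply/measurable_EFinP.
    by under eq_fun do rewrite -big_filter; exact: measurable_sum.
  apply: (@le_trans _ _ ((delta / k%:R)%:E * (2 * k%:R)%:E)); last first.
    rewrite -EFinM lee_fin; have [->|k0] := eqVneq k 0%N.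
      by rewrite !mulr0 mulr_ge0.
    by rewrite mulrCA divfK ?pnatr_eq0.
  rewrite lee_wpmul2l ?lee_fin ?divr_ge0//.
  under eq_integral do rewrite -big_filter -sumEFin.
  rewrite ge0_integral_sum//; last first.
    by move=> b; apply/measurable_EFinP.
  rewrite big_filter.
  apply: (@le_trans _ _ (\sum_(b | p i b) 2%:E)).
    apply: lee_sum => b pb.
    (* The radius passed to [subg_exp_moment] is the square root of the maximum: it is positive by
       [S0] and at least the norm of [V i b w]. *)
    have M0 : (0 < Num.max (S i b) (sqnorm (V i b w)))%R by rewrite lt_max S0.
    have M1 := sqr_sqrtr (ltW M0).
    rewrite -[in X in X <= _]M1.
    apply: subg_exp_moment => //; first by rewrite sqrtr_gt0.
    by rewrite M1 le_max lexx orbT.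
  rewrite sumEFin lee_fin sumr_const -[leLHS]mulr_natr ler_wpM2l// ler_nat.
  by rewrite -[leqRHS]card_ord max_card.
Qed.

End DecoupledMgf.

(** * Consequences of optimality *)

Section PsdDecomposition.
Context {R : realType} {n : nat}.
Implicit Types (W Y : 'M[R]_n) (x : 'I_n -> R).

Definition qform W x : R := \sum_i \sum_j x i * x j * W i j.

Lemma psd_sym W i j : psd W -> W i j = W j i.
Proof. by case=> sW _; rewrite -{1}sW mxE. Qed.

Lemma psd_qform_ge0 W x : psd W -> 0 <= qform W x.
Proof.
case=> _ /(_ (\col_i x i)); rewrite !mxE => h.
rewrite (le_trans h)// le_eqVlt; apply/orP; left; apply/eqP.
rewrite /qform exchange_big; apply: eq_bigr => j _.
rewrite !mxE mulr_suml; apply: eq_bigr => i _.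
by rewrite !mxE mulrAC.
Qed.

Lemma qform_shift W x i0 c : (forall i j, W i j = W j i) ->
  qform W (fun i => x i - c * (i == i0)%:R) =
  qform W x - 2 * c * \sum_j x j * W j i0 + c ^+ 2 * W i0 i0.
Proof.
move=> sW.
have E1 (F : 'I_n -> R) : \sum_i (i == i0)%:R * F i = F i0.
  rewrite (bigD1 i0)//= eqxx mul1r big1 ?addr0// => i /negbTE ->.
  by rewrite mul0r.
have -> : qform W (fun i => x i - c * (i == i0)%:R) = qform W x
    - c * (\sum_i (i == i0)%:R * (\sum_j x j * W i j))
    - c * (\sum_i x i * (\sum_j (j == i0)%:R * W i j))
    + c ^+ 2 * (\sum_i (i == i0)%:R * \sum_j (j == i0)%:R * W i j).
  rewrite /qform !mulr_sumr -!sumrN -!big_split /=.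
  apply: eq_bigr => i _; rewrite !mulr_sumr -!sumrN -!big_split /=.
  by apply: eq_bigr => j _; ring.
rewrite !E1.
under [in X in _ - X + _]eq_bigr do rewrite E1.
rewrite (eq_bigr (fun j => x j * W j i0)); last by move=> j _; rewrite sW.
ring.
Qed.

Definition psdf W := (forall i j, W i j = W j i) /\ forall x, 0 <= qform W x.

(** With a zero diagonal entry the form is affine along the direction [i0]. Were its slope [W j i0]
    nonzero, the shift chosen below would give the negative value [- qform W x - 2]. *)
Lemma psdf_col0 W i0 j : psdf W -> W i0 i0 = 0 -> W j i0 = 0.
Proof.
move=> [sW pW] W0; apply/eqP; apply: contraT => Wj0.
pose x i : R := (i == j)%:R.
have B : \sum_i x i * W i i0 = W j i0.
  rewrite (bigD1 j)//= /x eqxx mul1r big1 ?addr0// => i /negbTE ->.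
  by rewrite mul0r.
have := pW (fun i => x i - ((qform W x + 1) / W j i0) * (i == i0)%:R).
rewrite qform_shift// B W0 mulr0 addr0 -mulrA divfK//.
have := pW x; lra.
Qed.

(* When W i0 i0 = 0 the quotient is 0, which is harmless: the column i0 of W then
   vanishes. *)
Lemma psdf_deflate W i0 : psdf W ->
  psdf (\matrix_(i, j) (W i j - W i i0 * W j i0 / W i0 i0)).
Proof.
move=> pdW; have [sW pW] := pdW; split.
  by move=> i j; rewrite !mxE sW (mulrC (W i i0)).
move=> x.
have -> : qform (\matrix_(i, j) (W i j - W i i0 * W j i0 / W i0 i0)) x =
    qform W x - (\sum_j x j * W j i0) ^+ 2 / W i0 i0.
  rewrite expr2 !mulr_suml /qform -sumrN -big_split /=.
  apply: eq_bigr => i _; rewrite mulr_sumr mulr_suml -sumrN -big_split /=.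
  by apply: eq_bigr => j _; rewrite mxE; ring.
have [a0|a0] := eqVneq (W i0 i0) 0.
  by rewrite a0 invr0 mulr0 subr0.
(* This shift minimizes the form along [i0]; the minimum is the form of the Schur complement. *)
have := pW (fun i => x i - ((\sum_j x j * W j i0) / W i0 i0) * (i == i0)%:R).
rewrite qform_shift//.
by congr (_ <= _); field.
Qed.

(** Symmetric elimination: each pivot is split off as a rank-one term, the remainder stays positive
    semidefinite, and rows already eliminated stay zero. The columns of [y] are Gram vectors of
    [Y]. *)
Lemma psd_decomposition Y : psd Y ->
  exists y : 'I_n -> 'I_n -> R, forall i j, Y i j = \sum_r y r i * y r j.
Proof.
move=> pY.
have pdY : psdf Y.
  by split=> [i j|x]; [exact: psd_sym | exact: psd_qform_ge0].
suff : forall s : seq 'I_n, uniq s -> exists W (y : 'I_n -> 'I_n -> R),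
    [/\ psdf W, forall i j, i \in s -> W i j = 0 &
     forall i j, Y i j = W i j + \sum_(r <- s) y r i * y r j].
  case/(_ (enum 'I_n) (enum_uniq _)) => W [y [_ W0 Yy]].
  by exists y => i j; rewrite Yy W0 ?mem_enum// add0r big_enum.
elim=> [_|i0 s IHs /= /andP[nis us]].
  by exists Y, (fun _ _ => 0); split => // i j; rewrite big_nil addr0.
have [W [y [pW W0 Yy]]] := IHs us.
have sW := pW.1.
have ge0 : 0 <= W i0 i0.
  (* The basis vector at [i0] is written as a shift of zero, so that [qform_shift] evaluates the
     form to [W i0 i0]. *)
  have := pW.2 (fun i => 0 - (-1) * (i == i0)%:R).
  rewrite qform_shift// big1 => [|j _]; last by rewrite mul0r.
  rewrite /qform big1 => [|i _]; first by rewrite mulr0 subr0 add0r sqrrN expr1n mul1r.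
  by rewrite big1// => j _; rewrite !mul0r.
exists (\matrix_(i, j) (W i j - W i i0 * W j i0 / W i0 i0)).
exists (fun r i => if r == i0 then W i i0 / Num.sqrt (W i0 i0) else y r i).
split; first exact: psdf_deflate.
- move=> i j; rewrite inE mxE => /orP[/eqP ->|iss]; last first.
    by rewrite (W0 i j iss) (W0 i i0 iss) !mul0r subr0.
  have [a0|a0] := eqVneq (W i0 i0) 0.
    by rewrite a0 invr0 mulr0 subr0 sW psdf_col0.
  by rewrite mulrAC divff// mul1r sW subrr.
- move=> i j; rewrite big_cons eqxx Yy mxE.
  rewrite [in RHS](eq_big_seq (fun r => y r i * y r j)); last first.
    by move=> r rs; case: eqP => // rE; rewrite -rE rs in nis.
  rewrite mulrACA -invfM -expr2 sqr_sqrtr//; ring.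
Qed.

End PsdDecomposition.

Section Averages.
Context {R : realType} {n k d : nat}.
Variables (s : 'I_n -> 'I_k) (ell : R).

(** The normalization is the full cluster size [ell] for every [J], so the expression is additive in
    [J]; on the full set it is the cluster mean of the noise. *)
Definition partial_avg (J : {set 'I_n}) (x : 'I_n -> 'rV[R]_d) (b : 'I_k) : 'rV[R]_d :=
  ell^-1 *: \sum_(j | (j \in J) && (s j == b)) x j.

(** The squared operator norm of the matrix with rows [x i] is at most [Lam]. *)
Definition spectral_bound (Lam : R) (x : 'I_n -> 'rV[R]_d) :=
  forall v, \sum_i dotv (x i) v ^+ 2 <= Lam * sqnorm v.

(** The bound passes to the transposed matrix. With [u] the combination, [sqnorm u] is the inner
    product of [c] with the vector of all [dotv (x i) u]; Cauchy-Schwarz and the hypothesis bound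
    its square by [Lam * sqnorm u] times the sum of the [c i ^+ 2]. *)
Lemma spectral_bound_comb Lam x (c : 'I_n -> R) : 0 <= Lam -> spectral_bound Lam x ->
  sqnorm (\sum_i c i *: x i) <= Lam * \sum_i c i ^+ 2.
Proof.
move=> L0 sx; set u := \sum_i c i *: x i.
have uE : sqnorm u = dotv (\row_i c i) (\row_i dotv (x i) u).
  rewrite sqnormE {1}/u dotv_suml; apply: eq_bigr => i _.
  by rewrite dotvZl !mxE.
have := dotv_sqr_le (\row_i c i) (\row_i dotv (x i) u).
rewrite -uE.
have -> : sqnorm (\row_i c i) = \sum_i c i ^+ 2.
  by apply: eq_bigr => i _; rewrite mxE.
have -> : sqnorm (\row_i dotv (x i) u) = \sum_i dotv (x i) u ^+ 2.
  by apply: eq_bigr => i _; rewrite mxE.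
have c0 : 0 <= \sum_i c i ^+ 2 by apply: sumr_ge0 => i _; exact: sqr_ge0.
move=> /le_trans/(_ (ler_wpM2l c0 (sx u))).
have := sqnorm_ge0 u; rewrite le_eqVlt => /orP[/eqP <- _|u0].
  by rewrite mulr_ge0.
by rewrite expr2 mulrA ler_pM2r// (mulrC Lam).
Qed.

Hypothesis ell0 : 0 < ell.
Hypothesis bal : forall a, (#|[pred i | s i == a]|%:R = ell).

Lemma sqnorm_partial_avg Lam J x b : 0 <= Lam -> spectral_bound Lam x ->
  sqnorm (partial_avg J x b) <= Lam / ell.
Proof.
move=> L0 sx.
have -> : partial_avg J x b =
    \sum_i (((i \in J) && (s i == b))%:R / ell) *: x i.
  rewrite /partial_avg scaler_sumr big_mkcond; apply: eq_bigr => i _.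
  by case: ifP => _; rewrite ?mul1r// mul0r scale0r.
apply: le_trans (spectral_bound_comb _ L0 sx) _.
rewrite ler_wpM2l//.
apply: (@le_trans _ _ (\sum_(i | s i == b) ell ^-1 ^+ 2)).
  rewrite [leRHS]big_mkcond; apply: ler_sum => i _.
  case: (s i == b); last by rewrite andbF mul0r expr0n.
  case: (i \in J); first by rewrite mul1r.
  by rewrite mul0r expr0n sqr_ge0.
rewrite sumr_const -[leLHS]mulr_natr (bal b).
by rewrite expr2 -mulrA mulVf ?mulr1// gt_eqF.
Qed.

End Averages.

Section Deterministic.
Context {R : realType} {n k d : nat}.
Variables (s : 'I_n -> 'I_k) (mu : 'I_k -> 'rV[R]_d) (x : 'I_n -> 'rV[R]_d).
Variables (ell Lam : R) (Y : 'M[R]_n).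
Hypothesis ell0 : 0 < ell.
Hypothesis Lam0 : 0 <= Lam.
Hypothesis bal : forall a, (#|[pred i | s i == a]|%:R = ell).
Hypothesis ellE : n%:R / k%:R = ell.
Hypothesis sx : spectral_bound Lam x.
Hypothesis fY : sdp_feasible k Y.

Let same i j : R := (s i == s j)%:R.
Let avg b := partial_avg s ell [set: 'I_n]%SET x b.

Lemma Ystar_rowsum i : \sum_j Ystar s i j = ell :> R.
Proof.
under eq_bigr do rewrite mxE.
rewrite -(bal (s i)) -sum1_card natr_sum [RHS]big_mkcond.
by apply: eq_bigr => j _; rewrite inE eq_sym; case: eqP.
Qed.

Lemma qform_Ystar (z : 'I_n -> R) :
  qform (Ystar s) z = \sum_a (\sum_(i | s i == a) z i) ^+ 2.
Proof.
rewrite /qform.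
transitivity (\sum_a \sum_i \sum_j (z i * (s i == a)%:R) * (z j * (s j == a)%:R)).
  rewrite [RHS]exchange_big; apply: eq_bigr => i _.
  rewrite [RHS]exchange_big; apply: eq_bigr => j _; rewrite mxE.
  rewrite (bigD1 (s i))//= eqxx mulr1 big1; last first.
    by move=> a /negbTE; rewrite eq_sym => ->; rewrite mulr0 mul0r.
  by rewrite addr0 mulrA eq_sym.
apply: eq_bigr => a _; rewrite expr2 big_distrlr /= [in RHS]big_mkcond /=.
apply: eq_bigr => i _; case: (s i == a); last first.
  by rewrite big1// => j _; rewrite mulr0 mul0r.
rewrite [in RHS]big_mkcond /=; apply: eq_bigr => j _.
by case: (s j == a); rewrite ?mulr0// !mulr1.
Qed.

Lemma Ystar_psd : psd (Ystar s : 'M[R]_n).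
Proof.
split; first by apply/matrixP => i j; rewrite !mxE eq_sym.
move=> z.
have -> : (z^T *m Ystar s *m z) 0 0 = qform (Ystar s) (fun i => z i 0).
  rewrite !mxE /qform exchange_big; apply: eq_bigr => j _.
  rewrite !mxE mulr_suml; apply: eq_bigr => i _.
  by rewrite !mxE mulrAC.
by rewrite qform_Ystar; apply: sumr_ge0 => a _; exact: sqr_ge0.
Qed.

Lemma Ystar_feasible : sdp_feasible k (Ystar s : 'M[R]_n).
Proof.
split; [|exact: Ystar_psd| |].
- by move=> i; rewrite Ystar_rowsum ellE.
- by move=> i; rewrite mxE eqxx.
- by move=> i j; rewrite mxE.
Qed.

Lemma feasible_sym i j : Y i j = Y j i.
Proof. by case: fY => _ pY _ _; exact: psd_sym. Qed.

Lemma feasible_rowsum i : \sum_j Y i j = ell.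
Proof. by case: fY => + _ _ _; rewrite -ellE; exact. Qed.

Lemma feasible_ge0 i j : 0 <= Y i j.
Proof. by case: fY => _ _ _; exact. Qed.

(** The diagonal is 1, so the Gram vectors are unit vectors and [2 - 2 * Y i j] is a squared
    distance. *)
Lemma feasible_le1 i j : Y i j <= 1.
Proof.
case: fY => _ pY dY _; have [y Yy] := psd_decomposition pY.
have : 0 <= \sum_r (y r i - y r j) ^+ 2 by apply: sumr_ge0 => r _; exact: sqr_ge0.
have -> : \sum_r (y r i - y r j) ^+ 2 = Y i i - 2 * Y i j + Y j j.
  rewrite !Yy mulr_sumr -sumrN -!big_split /=.
  by apply: eq_bigr => r _; ring.
rewrite !dY; lra.
Qed.

Definition off_mass : R := \sum_i \sum_(j | s j != s i) Y i j.

Lemma in_deficit i : \sum_(j | s j == s i) (1 - Y i j) = \sum_(j | s j != s i) Y i j.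
Proof.
have := feasible_rowsum i; rewrite -(Ystar_rowsum i).
rewrite (bigID (fun j => s j == s i)) /= [RHS](bigID (fun j => s j == s i)) /=.
rewrite [X in _ = _ + X]big1 => [|j /negbTE]; last by rewrite mxE eq_sym => ->.
rewrite [X in _ = X + _](eq_bigr (fun=> 1)) => [|j /eqP]; last first.
  by rewrite mxE => ->; rewrite eqxx.
by rewrite sumrB; lra.
Qed.

(** Rows of [Y] and [Ystar s] have equal sums and [Y] has entries in [0,1], so the loss inside
    clusters equals the mass placed outside. *)
Lemma l1_off_mass : l1 (Y - Ystar s) = 2 * off_mass.
Proof.
rewrite /l1 /off_mass mulr_sumr; apply: eq_bigr => i _.
rewrite (bigID (fun j => s j == s i)) /=.
rewrite (eq_bigr (fun j => 1 - Y i j)) => [|j /eqP ji]; last first.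
  rewrite !mxE ji eqxx distrC ger0_norm// subr_ge0; exact: feasible_le1.
rewrite in_deficit [X in _ + X](eq_bigr (fun j => Y i j)); first by ring.
move=> j /negbTE; rewrite !mxE eq_sym => ->.
by rewrite subr0 ger0_norm// feasible_ge0.
Qed.

Lemma qform_dotv_Ystar_ge0 (q : 'I_n -> 'rV[R]_d) :
  0 <= \sum_i \sum_j Ystar s i j * dotv (q i) (q j).
Proof.
have -> : \sum_i \sum_j Ystar s i j * dotv (q i) (q j) =
    \sum_l qform (Ystar s) (fun i => q i 0 l).
  rewrite [RHS]exchange_big; apply: eq_bigr => i _.
  rewrite [RHS]exchange_big; apply: eq_bigr => j _.
  by rewrite mulr_sumr; apply: eq_bigr => l _; rewrite mulrC.
by apply: sumr_ge0 => l _; rewrite psd_qform_ge0//; exact: Ystar_psd.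
Qed.

(* Pythagoras for the projection onto functions constant on clusters. *)
Lemma sum_sqr_residual (y : 'I_n -> R) :
  \sum_j (y j - ell^-1 * \sum_(i | s i == s j) y i) ^+ 2 =
  \sum_j y j ^+ 2 - ell^-1 * qform (Ystar s) y.
Proof.
pose S a := \sum_(i | s i == a) y i.
have E1 : \sum_j y j * S (s j) = qform (Ystar s) y.
  rewrite qform_Ystar (partition_big s predT) //=.
  apply: eq_bigr => a _; rewrite expr2 mulr_suml.
  by apply: eq_bigr => i /eqP ->.
have E2 : \sum_j S (s j) ^+ 2 = ell * qform (Ystar s) y.
  rewrite qform_Ystar (partition_big s predT) //= mulr_sumr.
  apply: eq_bigr => a _; rewrite (eq_bigr (fun=> S a ^+ 2)); last by move=> i /eqP ->.
  by rewrite sumr_const -[LHS]mulr_natl; rewrite (bal a).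
transitivity (\sum_j y j ^+ 2 - 2 * ell^-1 * (\sum_j y j * S (s j))
    + ell^-1 ^+ 2 * \sum_j S (s j) ^+ 2).
  rewrite !mulr_sumr -sumrN -!big_split /=; apply: eq_bigr => j _.
  by rewrite /S; ring.
by rewrite E1 E2; field; rewrite gt_eqF.
Qed.

(** With Gram vectors of [Y] the left side is a sum of squared norms, and [spectral_bound_comb]
    bounds it by [Lam] times the squared residuals of the [y r]. By Pythagoras these total [n] minus
    the in-cluster mass over [ell], that is [off_mass / ell]. *)
Lemma residual_gram_le :
  \sum_i \sum_j Y i j * dotv (x i - avg (s i)) (x j - avg (s j))
    <= Lam / ell * off_mass.
Proof.
case: (fY) => _ pY dY _; have [y Yy] := psd_decomposition pY.
pose q i := x i - avg (s i).
have -> : \sum_i \sum_j Y i j * dotv (q i) (q j) =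
    \sum_r sqnorm (\sum_i y r i *: q i).
  under [RHS]eq_bigr => r _.
    rewrite sqnormE dotv_suml; under eq_bigr do rewrite dotvZl dotv_sumr mulr_sumr.
    over.
  rewrite [RHS]exchange_big; apply: eq_bigr => i _.
  rewrite [RHS]exchange_big; apply: eq_bigr => j _.
  by rewrite Yy mulr_suml; apply: eq_bigr => r _; rewrite dotvZr mulrA.
(* Projection onto cluster means is self-adjoint, so the centering moves from the vectors [x] to the
   coefficients [y r]. *)
have qE r : \sum_i y r i *: q i =
    \sum_j (y r j - ell^-1 * \sum_(i | s i == s j) y r i) *: x j.
  rewrite /q; under eq_bigr do rewrite scalerBr.
  under [RHS]eq_bigr do rewrite scalerBl.
  rewrite !sumrB; congr (_ - _).
  rewrite /avg /partial_avg.
  transitivity (\sum_i \sum_j (y r i * ell^-1 * same j i) *: x j).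
    apply: eq_bigr => i _; rewrite scalerA scaler_sumr big_mkcond /=.
    apply: eq_bigr => j _; rewrite finset.inE /same /=.
    by case: eqP => _; rewrite ?mulr1 ?mulr0 ?scale0r.
  rewrite exchange_big; apply: eq_bigr => j _.
  rewrite -scaler_suml; congr (_ *: _).
  rewrite mulr_sumr [RHS]big_mkcond; apply: eq_bigr => i _.
  by rewrite /same eq_sym mulrAC mulrC; case: eqP; rewrite ?mulr1 ?mulr0 // mulrC.
apply: (@le_trans _ _ (\sum_r Lam * (\sum_j y r j ^+ 2 - ell^-1 * qform (Ystar s) (y r)))).
  apply: ler_sum => r _; rewrite qE -sum_sqr_residual.
  exact: spectral_bound_comb.
rewrite -mulr_sumr -mulrA ler_wpM2l// sumrB -mulr_sumr.
have -> : \sum_r \sum_j y r j ^+ 2 = \sum_(j < n) 1.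
  rewrite exchange_big; apply: eq_bigr => j _.
  by rewrite -(dY j) Yy; apply: eq_bigr => r _; rewrite expr2.
have -> : \sum_r qform (Ystar s) (y r) = \sum_i \sum_(j | s j == s i) Y i j.
  rewrite exchange_big; apply: eq_bigr => i _.
  rewrite exchange_big [RHS]big_mkcond; apply: eq_bigr => j _.
  rewrite -mulr_suml mxE -Yy eq_sym.
  by case: eqP; rewrite ?mulr1 ?mulr0.
rewrite mulr_sumr -sumrB /off_mass mulr_sumr; apply: ler_sum => i _.
have := feasible_rowsum i; rewrite (bigID (fun j => s j == s i)) /= => h.
rewrite -(ler_pM2l ell0) mulrBr mulr1 !mulrA divff ?gt_eqF// !mul1r; lra.
Qed.

(** [m b] is the empirical center of cluster [b], and [x i - avg (s i)] is the residual of
    observation [i] about it. *)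
Let m b := mu b + avg b.
Let p i j := m (s j) - m (s i).

(** Compare with the feasible point [Ystar s] and expand the costs about the empirical centers.
    Terms in [i] or [j] alone vanish because [D] has zero row sums, terms with a factor [p i j] live
    on off-cluster pairs only, and the residual product is bounded by [residual_gram_le]. *)
Lemma sdp_opt_inequality : sdp_opt k (Amat (fun i => mu (s i) + x i)) Y ->
  0 <= \sum_i \sum_(j | s j != s i) Y i j *
    (2 * dotv (p i j) (x i - avg (s i)) - 2^-1 * sqnorm (p i j) + Lam / ell).
Proof.
case=> _ /(_ _ Ystar_feasible) opt.
pose q i := x i - avg (s i).
pose D i j := Y i j - Ystar s i j.
have symD i j : D i j = D j i by rewrite /D feasible_sym !mxE eq_sym.
have rowD i : \sum_j D i j = 0.
  by rewrite sumrB feasible_rowsum Ystar_rowsum subrr.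
have optD : \sum_i \sum_j D i j * sqnorm (mu (s i) + x i - (mu (s j) + x j)) <= 0.
  move: opt; rewrite -subr_le0; congr (_ <= _).
  rewrite /frob -sumrB; apply: eq_bigr => i _; rewrite -sumrB.
  by apply: eq_bigr => j _; rewrite [Amat _ _ _]mxE -mulrBl.
have hE i j : sqnorm (mu (s i) + x i - (mu (s j) + x j)) =
    sqnorm (p i j) - 2 * dotv (p i j) (q i) + 2 * dotv (p i j) (q j)
    + sqnorm (q i) + sqnorm (q j) - 2 * dotv (q i) (q j).
  have -> : mu (s i) + x i - (mu (s j) + x j) = q i - q j - p i j.
    by apply/rowP => l; rewrite /q /p /m !mxE; ring.
  rewrite !sqnormB dotvBl (dotvC (q i) (p i j)) (dotvC (q j) (p i j)); ring.
have Z1 : \sum_i \sum_j D i j * sqnorm (q i) = 0.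
  by apply: big1 => i _; rewrite -mulr_suml rowD mul0r.
have Z2 : \sum_i \sum_j D i j * sqnorm (q j) = 0.
  rewrite exchange_big /= -[RHS]Z1; apply: eq_bigr => i _.
  by apply: eq_bigr => j _; rewrite symD.
pose S := \sum_i \sum_j D i j * dotv (p i j) (q i).
(* Exchanging [i] and [j] preserves [D] and reverses [p]. *)
have Z3 : \sum_i \sum_j D i j * dotv (p i j) (q j) = - S.
  rewrite exchange_big /= /S -sumrN; apply: eq_bigr => i _.
  rewrite -sumrN; apply: eq_bigr => j _.
  by rewrite symD -mulrN -dotvNl /p opprB.
have Z4 : \sum_i \sum_j D i j * dotv (q i) (q j) <= Lam / ell * off_mass.
  apply: le_trans residual_gram_le; rewrite -subr_ge0.
  have := qform_dotv_Ystar_ge0 q; congr (_ <= _).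
  rewrite -sumrB; apply: eq_bigr => i _; rewrite -sumrB.
  by apply: eq_bigr => j _; rewrite /D /q; ring.
pose N := \sum_i \sum_j D i j * sqnorm (p i j).
have tot : N - 4 * S - 2 * (\sum_i \sum_j D i j * dotv (q i) (q j)) <= 0.
  apply: le_trans optD; rewrite le_eqVlt; apply/orP; left; apply/eqP.
  transitivity (N - 2 * S + 2 * (\sum_i \sum_j D i j * dotv (p i j) (q j))
    + (\sum_i \sum_j D i j * sqnorm (q i)) + (\sum_i \sum_j D i j * sqnorm (q j))
    - 2 * (\sum_i \sum_j D i j * dotv (q i) (q j))).
    by rewrite Z1 Z2 Z3; ring.
  rewrite /N /S !mulr_sumr -!sumrN -!big_split /=; apply: eq_bigr => i _.
  rewrite !mulr_sumr -!sumrN -!big_split /=; apply: eq_bigr => j _.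
  by rewrite hE; ring.
have offE (f : 'I_n -> 'I_n -> R) : (forall i j, s j == s i -> f i j = 0) ->
    \sum_i \sum_j D i j * f i j = \sum_i \sum_(j | s j != s i) Y i j * f i j.
  move=> f0; apply: eq_bigr => i _.
  rewrite (bigID (fun j => s j == s i)) /= big1 ?add0r => [|j ji]; last first.
    by rewrite f0 ?mulr0.
  by apply: eq_bigr => j /negbTE; rewrite /D mxE eq_sym => ->; rewrite subr0.
have p0 i j : s j == s i -> p i j = 0 by move=> /eqP; rewrite /p => ->; rewrite subrr.
move: tot; rewrite /N /S (offE (fun i j => sqnorm (p i j))); last first.
  by move=> i j /p0 ->; rewrite sqnormE dotv0l.
rewrite (offE (fun i j => dotv (p i j) (q i))); last first.
  by move=> i j /p0 ->; rewrite dotv0l.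
move=> tot.
pose NO := \sum_i \sum_(j | s j != s i) Y i j * sqnorm (p i j).
pose SO := \sum_i \sum_(j | s j != s i) Y i j * dotv (p i j) (q i).
have -> : \sum_i \sum_(j | s j != s i) Y i j *
    (2 * dotv (p i j) (x i - avg (s i)) - 2^-1 * sqnorm (p i j) + Lam / ell) =
    2 * SO - 2^-1 * NO + Lam / ell * off_mass.
  rewrite /SO /NO /off_mass !mulr_sumr -!sumrN -!big_split /=; apply: eq_bigr => i _.
  rewrite !mulr_sumr -!sumrN -!big_split /=; apply: eq_bigr => j _.
  by rewrite /q; ring.
move: tot; rewrite -/NO -/SO; lra.
Qed.

(** Returns from empirical to true separations. The constant 6 is 1 already present, 4 from Young's
    inequality on the product with [avg (s i)], and 1 from replacing a quarter of [sqnorm (p i j)]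
    by an eighth of the true squared distance. *)
Lemma off_pair_bound i j :
  2 * dotv (p i j) (x i - avg (s i)) - 2^-1 * sqnorm (p i j) + Lam / ell <=
  2 * dotv (p i j) (x i) - 8^-1 * sqnorm (mu (s j) - mu (s i)) + 6 * (Lam / ell).
Proof.
have ai b : sqnorm (avg b) <= Lam / ell by exact: sqnorm_partial_avg.
have a1 := ai (s i).
have h1 : - 2 * dotv (p i j) (avg (s i)) <=
    4^-1 * sqnorm (p i j) + 4 * sqnorm (avg (s i)).
  have := @dotv_le _ _ (- p i j) (avg (s i)) 4^-1.
  have -> : sqnorm (- p i j) = sqnorm (p i j).
    by rewrite !sqnormE dotvNl (dotvC _ (- _)) dotvNl opprK.
  rewrite dotvNl invrK => h; have : 0 < 4^-1 :> R by [].
  by move/h; lra.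
have h2 : 2^-1 * sqnorm (mu (s j) - mu (s i)) <=
    sqnorm (p i j) + sqnorm (avg (s j) - avg (s i)).
  have -> : mu (s j) - mu (s i) = p i j - (avg (s j) - avg (s i)).
    by apply/rowP => l; rewrite /p /m !mxE; ring.
  set e := avg (s j) - avg (s i).
  by have := sqnorm_ge0 (p i j + e); rewrite sqnormD (sqnormB _ e); lra.
have h3 : sqnorm (avg (s j) - avg (s i)) <= 4 * (Lam / ell).
  have := sqnorm_ge0 (avg (s j) + avg (s i)); have := ai (s j).
  by rewrite sqnormD sqnormB; lra.
rewrite dotvBr; lra.
Qed.

End Deterministic.

(** * Decoupling of the noise from the cluster averages *)

Section Decoupling.
Context {R : realType} {n k d : nat}.
Variables (s : 'I_n -> 'I_k) (mu : 'I_k -> 'rV[R]_d) (ell : R).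

Definition toggle (i : 'I_n) (J : {set 'I_n}) : {set 'I_n} :=
  if i \in J then (J :\ i)%SET else (i |: J)%SET.

Lemma in_toggle i J j : (j \in toggle i J) = (j == i) (+) (j \in J).
Proof.
by rewrite /toggle; case: ifP => iJ; rewrite !finset.inE; case: eqP => [->|_];
  rewrite ?iJ.
Qed.

Lemma toggleK i : involutive (toggle i).
Proof. by move=> J; apply/finset.setP => j; rewrite !in_toggle addbA addbb. Qed.

(* Toggling j pairs the subsets avoiding i that contain j with those that do
   not. *)
Lemma sum_toggle (i j : 'I_n) : j != i ->
  \sum_(J : {set 'I_n} | i \notin J) (j \in J)%:R * 2 =
  \sum_(J : {set 'I_n} | i \notin J) 1 :> R.
Proof.
move=> ji; rewrite -mulr_suml mulr_natr mulr2n.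
rewrite [X in _ + X](reindex_inj (inv_inj (toggleK j))) /=.
rewrite big_mkcond [X in _ + X]big_mkcond [RHS]big_mkcond -big_split /=; apply: eq_bigr => J _.
rewrite !in_toggle eqxx eq_sym (negbTE ji) /=.
by case: (i \in J) => //=; case: (j \in J); rewrite /= ?add0r ?addr0.
Qed.

Definition notin_count (i : 'I_n) : R := \sum_(J : {set 'I_n} | i \notin J) 1.

(** Toggling [i] matches the subsets avoiding [i] with those containing it. *)
Lemma notin_countE i : 2 * notin_count i = \sum_(J : {set 'I_n}) 1.
Proof.
rewrite /notin_count [RHS](bigID (fun J : {set 'I_n} => i \notin J)) /=.
rewrite [X in _ = _ + X](reindex_inj (inv_inj (toggleK i))) /=.
rewrite [X in _ = _ + X](eq_bigl (fun J : {set 'I_n} => i \notin J)); first by ring.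
by move=> J; rewrite in_toggle eqxx negbK.
Qed.

(** The factor 2 compensates for each index [j] other than [i] lying in only half of the subsets
    that avoid [i]. *)
Definition decoupled_vec (J : {set 'I_n}) (x : 'I_n -> 'rV[R]_d) (a b : 'I_k) :=
  mu b - mu a + 2 *: (partial_avg s ell J x b - partial_avg s ell J x a).

(** By [sum_toggle] every [j] other than [i] regains its full weight; the only discrepancy is the
    term [j = i], which no subset avoiding [i] provides. *)
Lemma sum_dotv_partial_avg (x : 'I_n -> 'rV[R]_d) i b :
  \sum_(J : {set 'I_n} | i \notin J) 2 * dotv (partial_avg s ell J x b) (x i) =
  notin_count i * (dotv (partial_avg s ell [set: 'I_n]%SET x b) (x i)
                   - ell^-1 * (s i == b)%:R * sqnorm (x i)).
Proof.
have E J : dotv (partial_avg s ell J x b) (x i) =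
    ell^-1 * \sum_(j | s j == b) (j \in J)%:R * dotv (x j) (x i).
  rewrite /partial_avg dotvZl dotv_suml; congr (_ * _).
  rewrite [LHS]big_mkcond [RHS]big_mkcond; apply: eq_bigr => j _.
  by case: (j \in J); case: (s j == b); rewrite ?mul1r ?mul0r.
under eq_bigr do rewrite E mulrCA mulr_sumr.
rewrite -mulr_sumr exchange_big /= E.
rewrite -mulrA -mulrBr mulrCA; congr (_ * _).
under [X in _ * (X - _)]eq_bigr do rewrite finset.inE mul1r.
have -> : (s i == b)%:R * sqnorm (x i) =
    \sum_(j | s j == b) (j == i)%:R * dotv (x j) (x i).
  rewrite big_mkcond (bigD1 i)//= eqxx mul1r sqnormE big1 ?addr0.
    by case: (s i == b); rewrite ?mul1r ?mul0r.
  by move=> j /negbTE ->; rewrite mul0r if_same.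
rewrite -sumrB mulr_sumr; apply: eq_bigr => j _.
have [->|ji] := eqVneq j i.
  rewrite mul1r subrr mulr0 big1// => J /negbTE ->.
  by rewrite mul0r mulr0.
rewrite mul0r subr0 /notin_count -(sum_toggle ji) mulr_suml.
by apply: eq_bigr => J _; ring.
Qed.

(** The missing self-interaction [sqnorm (x i) / ell] belongs to the subtracted average of cluster
    [s i], so losing it can only increase the right side. If [b] is [s i] the two corrections
    cancel. *)
Lemma decoupling_le (x : 'I_n -> 'rV[R]_d) i b : 0 < ell ->
  notin_count i * dotv (mu b + partial_avg s ell [set: 'I_n]%SET x b
     - (mu (s i) + partial_avg s ell [set: 'I_n]%SET x (s i))) (x i) <=
  \sum_(J : {set 'I_n} | i \notin J) dotv (decoupled_vec J x (s i) b) (x i).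
Proof.
move=> ell0.
have -> : \sum_(J : {set 'I_n} | i \notin J) dotv (decoupled_vec J x (s i) b) (x i) =
    notin_count i * dotv (mu b - mu (s i)) (x i) +
    (\sum_(J : {set 'I_n} | i \notin J) 2 * dotv (partial_avg s ell J x b) (x i) -
     \sum_(J : {set 'I_n} | i \notin J) 2 * dotv (partial_avg s ell J x (s i)) (x i)).
  rewrite /notin_count mulr_suml -sumrB -big_split /=; apply: eq_bigr => J _.
  by rewrite /decoupled_vec dotvDl dotvZl !dotvBl; ring.
rewrite !sum_dotv_partial_avg -mulrBr -mulrDr ler_wpM2l ?sumr_ge0//.
have : (s i == b)%:R <= 1 :> R by rewrite lern1; case: eqP.
rewrite eqxx (_ : true%:R = 1 :> R)//; move: ((s i == b)%:R : R) => B B1.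
have e0 : 0 <= ell^-1 * sqnorm (x i) by rewrite mulr_ge0 ?sqnorm_ge0// invr_ge0 ltW.
by have := ler_wpM2l e0 B1; rewrite !dotvBl !dotvDl; lra.
Qed.

End Decoupling.

(** * Scalar inequalities for the exponential *)

Section ExponentialBounds.
Context {R : realType}.

(** Jensen's inequality, by summing the tangent-line bound at the mean. *)
Lemma expR_mean_le (I : finType) (u : I -> R) : (0 < #|I|)%N ->
  expR ((\sum_i u i) / #|I|%:R) <= (\sum_i expR (u i)) / #|I|%:R.
Proof.
move=> I0; have N0 : 0 < #|I|%:R :> R by rewrite ltr0n.
set m := (\sum_i u i) / #|I|%:R.
have mE : \sum_i u i = m * #|I|%:R by rewrite /m divfK ?gt_eqF.
rewrite ler_pdivlMr//.
have -> : expR m * #|I|%:R = \sum_i expR m * (1 + (u i - m)).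
  rewrite -mulr_sumr big_split /= sumrB !sumr_const mE -(mulr_natr m).
  by rewrite subrr addr0.
apply: ler_sum => i _.
have -> : expR (u i) = expR m * expR (u i - m) by rewrite -expRD addrC subrK.
by rewrite ler_pM2l ?expR_gt0// expR_ge1Dx.
Qed.

(** If the positive part is zero the left side is 1. Otherwise [t > D / 32], and half of
    [X = t ^+ 2 / (theta2 * (4 * D))] dominates the exponent on the left while the other half
    dominates [Delta2 / (128 * (64 * theta2))]. *)
Lemma expR_pos_part_le (k t D Delta2 theta2 : R) :
  0 < theta2 -> 0 < k -> 0 < Delta2 -> Delta2 <= D -> 512 * k * theta2 <= Delta2 ->
  expR (k * (Num.max 0 (2 * t - D / 16) / Delta2)) <=
  1 + expR (- (Delta2 / (128 * (64 * theta2)))) * expR (t ^+ 2 / (theta2 * (4 * D))).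
Proof.
move=> th0 k0 D20 DD kth.
have D0 : 0 < D by exact: lt_le_trans DD.
have [tD|tD] := leP (2 * t - D / 16) 0.
  by rewrite mul0r mulr0 expR0 lerDl mulr_ge0 ?expR_ge0.
rewrite -expRD ler_wpDl//ler_expR.
have t0 : D / 32 < t by lra.
have t00 : 0 < t by apply: lt_trans t0; rewrite divr_gt0.
pose X := t ^+ 2 / (theta2 * (4 * D)).
have dn : 0 < 8 * D * theta2 by rewrite !mulr_gt0.
have XE : X / 2 = t ^+ 2 / (8 * D * theta2).
  by rewrite /X; field; rewrite !gt_eqF.
have h1 : k * ((2 * t - D / 16) / Delta2) <= X / 2.
  rewrite XE mulrA ler_pdivrMr// mulrAC ler_pdivlMr//.
  have a1 : 16 * k * theta2 * D <= t * Delta2.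
    have := ler_wpM2r (ltW D0) kth.
    have := ler_wpM2r (ltW D20) (ltW t0); nra.
  have := ler_wpM2r (ltW t00) a1.
  have : 0 <= k * (D * (D * theta2)) by rewrite !mulr_ge0// ltW.
  rewrite expr2; nra.
have h2 : Delta2 / (128 * (64 * theta2)) <= X / 2.
  rewrite XE ler_pdivlMr// mulrAC ler_pdivrMr ?mulr_gt0//.
  have a2 : D ^+ 2 <= 1024 * t ^+ 2.
    have : (D / 32) ^+ 2 <= t ^+ 2 by rewrite ler_sqr ?nnegrE ?ltW// divr_gt0.
    by rewrite expr_div_n; lra.
  have a3 : Delta2 * D <= D ^+ 2 by rewrite expr2 ler_wpM2r// ltW.
  have := ler_wpM2r (ltW th0) (le_trans a3 a2); nra.
rewrite -/X; lra.
Qed.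

End ExponentialBounds.

(** * Entrywise error of the SDP optimum for a fixed realization of the noise *)

Section Conclusion.
Context {R : realType} {n k d : nat}.
Variables (s : 'I_n -> 'I_k) (mu : 'I_k -> 'rV[R]_d) (x : 'I_n -> 'rV[R]_d).
Variables (ell Lam Delta2 theta2 : R).
Hypothesis ell0 : 0 < ell.
Hypothesis Lam0 : 0 <= Lam.
Hypothesis bal : forall a, (#|[pred i | s i == a]|%:R = ell).
Hypothesis ellE : n%:R / k%:R = ell.
Hypothesis sx : spectral_bound Lam x.
Hypothesis Delta20 : 0 < Delta2.
Hypothesis theta20 : 0 < theta2.
Hypothesis sep : forall a b, a != b -> Delta2 <= sqnorm (mu a - mu b).
Hypothesis LamD : 192 * Lam <= Delta2 * ell.
Hypothesis kD : 512 * k%:R * theta2 <= Delta2.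
Hypothesis k0 : (0 < k)%N.

Let D i b := sqnorm (mu b - mu (s i)).
Let dvec J i b := decoupled_vec s mu ell J x (s i) b.
Let delta := expR (- (Delta2 / (128 * (64 * theta2)))).

(** It has the shape of [decoupled_factor] with [S = 4 * D], so its mean is controlled for arbitrary
    noise, while under the spectral bound it dominates the exponential excess at [i]. *)
Definition surrogate (J : {set 'I_n}) (i : 'I_n) : R :=
  1 + delta / k%:R * \sum_(b | b != s i) expR (dotv (x i) (dvec J i b) ^+ 2 /
    (theta2 * Num.max (4 * D i b) (sqnorm (dvec J i b)))).

Let LamE : 192 * (Lam / ell) <= Delta2.
Proof. by rewrite mulrA ler_pdivrMr. Qed.

(** The left side is at most [2 * D i b + 8 * sqnorm e], with [sqnorm e <= 4 * (Lam / ell)] and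
    [192 * (Lam / ell) <= Delta2 <= D i b]. Hence the maximum in [surrogate] is the deterministic
    [4 * D i b]. *)
Lemma sqnorm_decoupled_vec J i b : b != s i -> sqnorm (dvec J i b) <= 4 * D i b.
Proof.
move=> bi; have sD := sep bi.
set e := partial_avg s ell J x b - partial_avg s ell J x (s i).
have dE : dvec J i b = mu b - mu (s i) + 2 *: e by [].
have e1 : sqnorm e <= 4 * (Lam / ell).
  have := sqnorm_ge0 (partial_avg s ell J x b + partial_avg s ell J x (s i)).
  have := sqnorm_partial_avg ell0 bal J b Lam0 sx.
  have := sqnorm_partial_avg ell0 bal J (s i) Lam0 sx.
  by rewrite sqnormD /e sqnormB; lra.
have := sqnorm_ge0 (mu b - mu (s i) - 2 *: e).
rewrite dE (sqnormB _ (2 *: e)) (sqnormD _ (2 *: e)) sqnormZ /D.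
by have := Delta20; move: sD LamE e1; rewrite (_ : 2 ^+ 2 = 4 :> R); [lra|ring].
Qed.

Let pos J i b := Num.max 0 (2 * dotv (dvec J i b) (x i) - D i b / 16).

(** Jensen over the [k] labels turns the exponential of a sum into a mean of exponentials with
    exponents multiplied by [k]; the label [s i] contributes exponent 0. Then [expR_pos_part_le]
    applies to each label. *)
Lemma expR_pos_le_surrogate J i :
  expR (\sum_(b | b != s i) pos J i b / Delta2) <= surrogate J i.
Proof.
have kR0 : 0 < k%:R :> R by rewrite ltr0n.
pose U b : R := if b != s i then k%:R * (pos J i b / Delta2) else 0.
have -> : \sum_(b | b != s i) pos J i b / Delta2 = (\sum_b U b) / #|'I_k|%:R.
  rewrite /U -big_mkcond -mulr_sumr card_ord mulrC mulrA mulVf ?mul1r//.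
  by rewrite gt_eqF.
apply: le_trans (expR_mean_le U _) _; first by rewrite card_ord.
rewrite card_ord ler_pdivrMr// /surrogate mulrDl mul1r mulrAC divfK ?gt_eqF//.
have -> : k%:R = \sum_(b < k) 1 :> R by rewrite sumr_const card_ord.
rewrite mulr_sumr [X in _ + X]big_mkcond -big_split /=.
apply: ler_sum => b _; rewrite /U; case: ifP => [bi|_]; last by rewrite expR0 addr0.
have db := sqnorm_decoupled_vec J bi.
rewrite (max_idPl db) dotvC.
apply: expR_pos_part_le => //; exact: sep.
Qed.

Let N : R := #|{set 'I_n}|%:R.

(** Jensen over the subsets [J]: the exponential of the mean excess is at most the mean of the
    products of surrogates. *)
Lemma decoupled_mass_le (T : R) :
  (\sum_(J : {set 'I_n}) \prod_(i | i \notin J) surrogate J i) / N < expR T ->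
  (\sum_(J : {set 'I_n}) \sum_(i | i \notin J) \sum_(b | b != s i) pos J i b)
    <= N * Delta2 * T.
Proof.
move=> ZT.
have N0 : (0 < #|{set 'I_n}|)%N by apply/card_gt0P; exists finset.set0.
have N0R : 0 < N by rewrite ltr0n.
pose W (J : {set 'I_n}) := \sum_(i | i \notin J) \sum_(b | b != s i) pos J i b / Delta2.
have WE : \sum_(J : {set 'I_n}) \sum_(i | i \notin J) \sum_(b | b != s i) pos J i b =
    Delta2 * \sum_J W J.
  rewrite mulr_sumr; apply: eq_bigr => J _; rewrite mulr_sumr.
  apply: eq_bigr => i _; rewrite mulr_sumr; apply: eq_bigr => b _.
  by rewrite mulrCA divff ?mulr1// gt_eqF.
have : (\sum_J W J) / N < T.
  rewrite -ltr_expR; apply: le_lt_trans ZT.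
  apply: le_trans (expR_mean_le W N0) _.
  rewrite ler_wpM2r ?invr_ge0 ?(ltW N0R)//; apply: ler_sum => J _.
  rewrite /W expR_sum; apply: ler_prod => i _.
  by rewrite expR_ge0 expR_pos_le_surrogate.
rewrite ltr_pdivrMr// => /ltW h.
by rewrite WE (mulrC N) -mulrA ler_wpM2l ?(ltW Delta20)// (mulrC N).
Qed.

Variable Y : 'M[R]_n.
Hypothesis fY : sdp_feasible k Y.
Hypothesis optY : sdp_opt k (Amat (fun i => mu (s i) + x i)) Y.

Let avg b := partial_avg s ell [set: 'I_n]%SET x b.
Let p i b := mu b + avg b - (mu (s i) + avg (s i)).
Let pos0 i b := Num.max 0 (2 * dotv (p i b) (x i) - D i b / 16).

(** Of the gain [D / 8] in [off_pair_bound], half stays in [pos0]; the rest is at least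
    [Delta2 / 16], which pays [6 * (Lam / ell) <= Delta2 / 32] and leaves [Delta2 / 32]. The mass
    sent by row [i] into one cluster is at most the row sum [ell]. *)
Lemma off_mass_le : Delta2 / 32 * off_mass s Y <=
  ell * \sum_i \sum_(b | b != s i) pos0 i b.
Proof.
have h := sdp_opt_inequality ell0 Lam0 bal ellE sx fY optY.
have h2 : 0 <= \sum_i \sum_(j | s j != s i)
    Y i j * (2 * dotv (p i (s j)) (x i) - D i (s j) / 16 - Delta2 / 32).
  apply: le_trans h _; apply: ler_sum => i _; apply: ler_sum => j ji.
  apply: ler_wpM2l; first exact: (feasible_ge0 fY).
  have := off_pair_bound mu ell0 Lam0 bal sx i j.
  have := sep ji; move: LamE.
  rewrite /p /D /avg; lra.
have -> : Delta2 / 32 * off_mass s Y = \sum_i \sum_(j | s j != s i)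
    Y i j * (Delta2 / 32).
  rewrite /off_mass mulr_sumr; apply: eq_bigr => i _.
  by rewrite mulr_sumr; apply: eq_bigr => j _; rewrite mulrC.
have h3 : \sum_i \sum_(j | s j != s i) Y i j * (Delta2 / 32) <=
    \sum_i \sum_(j | s j != s i) Y i j * pos0 i (s j).
  rewrite -subr_ge0; apply: le_trans h2 _; rewrite -sumrB.
  apply: ler_sum => i _; rewrite -sumrB; apply: ler_sum => j _.
  rewrite -mulrBr ler_wpM2l ?(feasible_ge0 fY)// lerD2r.
  by rewrite le_max lexx orbT.
apply: le_trans h3 _; rewrite mulr_sumr; apply: ler_sum => i _.
rewrite (partition_big s (fun b => b != s i)) //= mulr_sumr.
apply: ler_sum => b bi.
rewrite (eq_bigr (fun j => Y i j * pos0 i b)); last first.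
  by move=> j /andP[_ /eqP ->].
rewrite -mulr_suml ler_wpM2r//; first by rewrite le_max lexx.
rewrite -(feasible_rowsum ellE fY i) [leLHS]big_mkcond; apply: ler_sum => j _.
by case: ifP => // _; exact: (feasible_ge0 fY).
Qed.

(** The positive part is convex, so after [decoupling_le] it passes inside the average over [J]. *)
Lemma pos0_le i b : notin_count i * pos0 i b <=
  \sum_(J : {set 'I_n} | i \notin J) pos J i b.
Proof.
have c0 : 0 <= notin_count i :> R by exact: sumr_ge0.
rewrite /pos0 maxr_pMr// mulr0 ge_max; apply/andP; split.
  by apply: sumr_ge0 => J _; rewrite le_max lexx.
apply: (@le_trans _ _ (\sum_(J : {set 'I_n} | i \notin J)
    (2 * dotv (dvec J i b) (x i) - D i b / 16))); last first.
  by apply: ler_sum => J _; rewrite le_max lexx orbT.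
rewrite sumrB -mulr_sumr -/(notin_count i) mulrBr.
have -> : \sum_(J : {set 'I_n} | i \notin J) D i b / 16 = notin_count i * (D i b / 16).
  by rewrite [RHS]mulr_suml; apply: eq_bigr => J _; rewrite mul1r.
rewrite lerD2r mulrCA ler_wpM2l//; exact: decoupling_le.
Qed.

(** The constant 128 is a product of 2 from [l1_off_mass], 32 from [off_mass_le] and 2 because half
    of all subsets avoid [i]. *)
Lemma l1_error_le (T : R) :
  (\sum_(J : {set 'I_n}) \prod_(i | i \notin J) surrogate J i) / N < expR T ->
  l1 (Y - Ystar s) <= 128 * ell * T.
Proof.
move=> /decoupled_mass_le hT.
have N0R : 0 < N by rewrite ltr0n; apply/card_gt0P; exists finset.set0.
have cE (i : 'I_n) : notin_count i = N / 2 :> R.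
  have := @notin_countE R n i; rewrite sumr_const => h.
  by rewrite /N -h mulrC mulKf.
have h : N / 2 * (\sum_i \sum_(b | b != s i) pos0 i b) <= N * Delta2 * T.
  apply: le_trans hT; rewrite mulr_sumr.
  rewrite (exchange_big_dep predT) //=; apply: ler_sum => i _.
  rewrite mulr_sumr exchange_big; apply: ler_sum => b _.
  by rewrite -(cE i) pos0_le.
rewrite (l1_off_mass bal ellE fY).
have := off_mass_le.
set A := \sum_i _ in h *; set B := off_mass _ _.
have E : N * Delta2 * T = N / 2 * (2 * Delta2 * T) by field.
move: h; rewrite E ler_pM2l ?divr_gt0// => h.
have := ler_wpM2l (ltW ell0) h => h' h''.
rewrite -(ler_pM2l Delta20); nra.
Qed.

End Conclusion.

(** * The rounding procedure *)

Section Rounding.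
Local Open Scope set_scope.

(** Points of [A] are added one at a time, composing with a transposition that corrects the new
    image and fixes the earlier ones. *)
Lemma perm_extend (k : nat) (A : {set 'I_k}) (f : 'I_k -> 'I_k) :
  {in A &, injective f} -> exists p : {perm 'I_k}, {in A, p =1 f}.
Proof.
move=> injf.
suff : forall r : seq 'I_k, uniq r -> {subset r <= A} ->
    exists p : {perm 'I_k}, {in r, p =1 f}.
  case/(_ (enum A) (enum_uniq _)) => [a|p pf]; first by rewrite mem_enum.
  by exists p => a aA; rewrite pf// mem_enum.
elim=> [_ _|a r IHr /= /andP[ar ur] rA]; first by exists 1%g.
have [|p pf] := IHr ur; first by move=> b br; rewrite rA// inE br orbT.
exists (p * tperm (p a) (f a))%g => b; rewrite inE permM.
have [->|ba] := eqVneq b a => [_|/= br]; first by rewrite tpermL.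
have fab : f a != f b.
  apply: contra_neq ba => /injf <- //; rewrite rA ?inE ?eqxx ?br ?orbT//.
rewrite tpermD; first exact: pf.
- by rewrite (inj_eq perm_inj) eq_sym.
- by rewrite pf.
Qed.

Lemma bigminn_le (I : finType) (n : nat) (F : I -> nat) (i0 : I) :
  (\big[minn/n]_i F i <= F i0)%N.
Proof.
have : i0 \in index_enum I by rewrite mem_index_enum.
elim: (index_enum I) => // i r IHr; rewrite inE big_cons.
by case: eqP => [->|_ /= /IHr]; [rewrite geq_minl|exact: leq_trans (geq_minr _ _)].
Qed.

(** After cancelling the common part, the largest weight [M] in [F :\: S] separates the two
    differences, and [F :\: S] has no more elements than [S :\: F]. *)
Lemma sum_card_select_le (I : finType) (F S : {set I}) (w : I -> nat) :
  (#|F| <= #|S|)%N ->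
  (forall t t', t \in F -> t \notin S -> t' \in S -> w t <= w t')%N ->
  (\sum_(t in F) w t <= \sum_(t in S) w t)%N.
Proof.
move=> FS wFS.
rewrite (big_setID S) /= [X in (_ <= X)%N](big_setID F) /= finset.setIC leq_add2l.
pose M := \max_(t in F :\: S) w t.
apply: (@leq_trans (#|F :\: S| * M)).
  rewrite -sum_nat_const; apply: leq_sum => t tF.
  exact: (@leq_bigmax_cond _ (mem (F :\: S)) w t tF).
apply: (@leq_trans (#|S :\: F| * M)).
  rewrite leq_mul2r; apply/orP; right.
  by rewrite -(leq_add2l #|F :&: S|) cardsID finset.setIC cardsID.
rewrite -sum_nat_const; apply: leq_sum => t'; rewrite finset.in_setD => /andP[_ tS].
apply/bigmax_leqP => t; rewrite finset.in_setD => /andP[tS' tF].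
exact: wFS.
Qed.

Context {R : realType} {n k : nat}.
Variables (Y : 'M[R]_n) (s : 'I_n -> 'I_k).
Hypothesis k0 : (0 < k)%N.
Hypothesis bal : forall a, #|[pred i | s i == a]| = (n %/ k)%N.
Hypothesis kn : (k %| n)%N.
Hypothesis n0 : (0 < n)%N.

Let ell : R := (n %/ k)%:R.

Let ellE : n%:R / k%:R = ell.
Proof.
have kR : k%:R != 0 :> R by rewrite pnatr_eq0 -lt0n.
by rewrite /ell -{1}(divnK kn) natrM mulfK.
Qed.

Let ell0 : 0 < ell.
Proof. by rewrite -ellE divr_gt0 ?ltr0n. Qed.

Definition row_err i : R := \sum_j `|Y i j - Ystar s i j|.
(** The threshold is half the ball radius [ell / 4], so two good rows of one cluster lie in each
    other's ball. *)
Definition bad_rows : {set 'I_n} := [set i | ell / 8 < row_err i].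
Definition good_rows a : {set 'I_n} := [set i | (s i == a) && (i \notin bad_rows)].

Lemma in_good_rows i a : (i \in good_rows a) = (s i == a) && (i \notin bad_rows).
Proof. by rewrite finset.in_set. Qed.

Lemma good_row_err i : i \notin bad_rows -> row_err i <= ell / 8.
Proof. by rewrite inE -leNgt. Qed.

Lemma card_bad_rows : #|bad_rows|%:R * ell <= 8 * l1 (Y - Ystar s).
Proof.
have -> : l1 (Y - Ystar s) = \sum_i row_err i.
  by apply: eq_bigr => i _; apply: eq_bigr => j _; rewrite !mxE.
rewrite -sum1_card natr_sum mulr_suml mulr_sumr big_mkcond.
apply: ler_sum => i _.
have r0 : 0 <= row_err i by apply: sumr_ge0 => j _.
by rewrite inE; case: ltP => h; lra.
Qed.

Lemma row_dist_triangle u v w :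
  row_dist Y u w <= row_dist Y u v + row_dist Y v w.
Proof.
rewrite /row_dist -big_split; apply: ler_sum => j _.
by rewrite -[X in `|X|](subrKA (Y v j)) ler_normD.
Qed.

Lemma row_distC u w : row_dist Y u w = row_dist Y w u.
Proof. by apply: eq_bigr => j _; rewrite distrC. Qed.

Lemma good_row_dist u w : s u = s w -> u \notin bad_rows -> w \notin bad_rows ->
  row_dist Y u w <= n%:R / (4 * k%:R).
Proof.
move=> suw /good_row_err ub /good_row_err wb.
have -> : n%:R / (4 * k%:R) = ell / 4 by rewrite -ellE invfM mulrCA mulrC.
apply: (@le_trans _ _ (row_err u + row_err w)); last by lra.
rewrite /row_err -big_split; apply: ler_sum => j _.
have -> : Ystar s w j = Ystar s u j :> R by rewrite !mxE suw.
rewrite (distrC (Y w j)).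
by rewrite -[X in `|X|](subrKA (Ystar s u j)) ler_normD.
Qed.

Lemma good_row_sep u w w' : w \notin bad_rows -> w' \notin bad_rows ->
  row_dist Y u w <= n%:R / (4 * k%:R) -> row_dist Y u w' <= n%:R / (4 * k%:R) ->
  s w = s w'.
Proof.
have -> : n%:R / (4 * k%:R) = ell / 4 by rewrite -ellE invfM mulrCA mulrC.
move=> /good_row_err wb /good_row_err wb' d d'.
apply/eqP/negP => /negP ww'.
have dd := row_dist_triangle w u w'; rewrite (row_distC w u) in dd.
(* Columns in the cluster of [w] alone already separate the planted rows by [ell], whereas the right
   side is at most [ell / 8 + ell / 2 + ell / 8]. *)
have : ell <= row_err w + row_dist Y w w' + row_err w'.
  apply: (@le_trans _ _ (\sum_j `|Ystar s w j - Ystar s w' j| : R)).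
    rewrite /ell -(bal (s w)) -sum1_card natr_sum big_mkcond.
    apply: ler_sum => j _; rewrite inE !mxE.
    case: eqP => [->|_]; last exact: normr_ge0.
    by rewrite eqxx eq_sym (negbTE ww') subr0 normr1.
  rewrite /row_err /row_dist -!big_split /=; apply: ler_sum => j _.
  rewrite (distrC (Y w j) (Ystar s w j)).
  by rewrite -addrA (le_trans (ler_distD (Y w j) _ _))// lerD2l ler_distD.
have := ell0; lra.
Qed.

Variable Bs : seq {set 'I_n}.
Hypothesis step1Bs : step1 k Y Bs.
Let B t := nth finset.set0 Bs t.

Lemma in_Vt i t : (i \in Vt Bs t) = [forall t' : 'I_t, i \notin B t'].
Proof.
rewrite finset.inE; apply/negP/forallP => [iB t'|iB /bigcupP[t' _ it']].
  by apply/negP => it'; apply: iB; apply/bigcupP; exists t'.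
by have := iB t'; rewrite /B it'.
Qed.

(** The ball of any surviving good row contains all surviving good rows of its cluster, so the
    maximal ball is at least as large. A truncated block still has the size of a full cluster. *)
Lemma block_ballP t : (t < size Bs)%N -> exists u,
  [/\ B t \subset Bball k Y (Vt Bs t) u &
   forall a, (#|good_rows a :&: Vt Bs t| <= #|B t|)%N].
Proof.
case: step1Bs => + _ => /(_ t) + tB => /(_ tB)[u [uV umax Bu]]; exists u.
have key a : (#|good_rows a :&: Vt Bs t| <= #|Bball k Y (Vt Bs t) u|)%N.
  have [->|[v]] := finset.set_0Vmem (good_rows a :&: Vt Bs t).
    by rewrite finset.cards0.
  rewrite !finset.inE => /andP[/andP[/eqP va vb] vV].
  apply: leq_trans (umax v _); last by rewrite finset.inE.
  apply: subset_leq_card; apply/fintype.subsetP => w.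
  rewrite !finset.inE => /andP[/andP[/eqP wa wb] wV].
  by rewrite wV; apply: good_row_dist; rewrite ?va ?wa// finset.inE.
move: Bu; case: ifP => _ => [BE|[BB cB]]; split => //; first by rewrite /B BE.
  by move=> a; rewrite /B BE.
move=> a; rewrite [X in (_ <= X)%N]cB -(bal a) subset_leq_card//.
by apply/fintype.subsetP => w; rewrite !finset.inE => /andP[/andP[]].
Qed.

Lemma block_sub_Vt t : (t < size Bs)%N -> B t \subset Vt Bs t.
Proof.
move=> tB; have [u [/fintype.subsetP Bu _]] := block_ballP tB.
by apply/fintype.subsetP => w /Bu; rewrite finset.inE => /andP[].
Qed.

Lemma block_pure t w w' : (t < size Bs)%N -> w \in B t -> w' \in B t ->
  w \notin bad_rows -> w' \notin bad_rows -> s w = s w'.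
Proof.
move=> tB; have [u [/fintype.subsetP Bu _]] := block_ballP tB.
move=> /Bu; rewrite finset.inE => /andP[_ d] /Bu; rewrite finset.inE => /andP[_ d'].
by move=> wb wb'; exact: good_row_sep d d'.
Qed.

Lemma block_cover i : exists t : 'I_(size Bs), i \in B t.
Proof.
case: step1Bs => _ V0.
have : i \notin Vt Bs (size Bs) by rewrite V0 finset.inE.
by rewrite in_Vt negb_forall => /existsP[t]; rewrite negbK; exists t.
Qed.

Lemma block_inj i t t' : (t < size Bs)%N -> (t' < size Bs)%N ->
  i \in B t -> i \in B t' -> t = t'.
Proof.
wlog : t t' / (t <= t')%N => [h|].
  by case: (leqP t t') => [|/ltnW] tt' *; [exact: h|apply/esym/h].
rewrite leq_eqVlt => /orP[/eqP //|tt'] _ tB' it /(fintype.subsetP (block_sub_Vt tB')).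
by rewrite in_Vt => /forallP/(_ (Ordinal tt')); rewrite it.
Qed.

Variables (sig : 'I_n -> 'I_k) (sel : 'I_k -> 'I_(size Bs)).
Hypothesis sel_inj : injective sel.
Hypothesis sel_large : forall t : 'I_(size Bs), t \notin codom sel ->
  forall j, (#|B t| <= #|B (sel j)|)%N.
Hypothesis sel_sig : forall j, B (sel j) \subset [set i | sig i == j].

Definition block_of (i : 'I_n) : 'I_(size Bs) :=
  xchoose (block_cover i).

Lemma block_ofP i (t : 'I_(size Bs)) : (i \in B t) = (block_of i == t).
Proof.
have h := xchooseP (block_cover i).
apply/idP/eqP => [it|<-//].
by apply/val_inj; exact: block_inj h it.
Qed.

Lemma sum_card_blocks (X : {set 'I_n}) :
  (\sum_(t < size Bs) #|B t :&: X| = #|X|)%N.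
Proof.
rewrite -[RHS]sum1_card (partition_big block_of predT)//=.
apply: eq_bigr => t _; rewrite -sum1_card; apply: eq_bigl => i.
by rewrite finset.inE block_ofP andbC.
Qed.

(* The default value of insubd is only reached when good_rows a is empty. *)
Definition first_block (a : 'I_k) : 'I_(size Bs) :=
  insubd (sel (Ordinal k0)) (find (fun C => good_rows a :&: C != finset.set0) Bs).

(** Earlier blocks miss the good rows of [a], so all of them are still available when this block is
    chosen and the greedy comparison involves the whole set. *)
Lemma first_blockP a : good_rows a != finset.set0 ->
  (exists2 i, i \in good_rows a & i \in B (first_block a)) /\
  (good_rows a \subset Vt Bs (first_block a)).
Proof.
move=> /finset.set0Pn[i ia].
have hasa : has (fun C => good_rows a :&: C != finset.set0) Bs.
  have [t it] := block_cover i; apply/hasP; exists (B t); first exact: mem_nth.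
  by apply/finset.set0Pn; exists i; rewrite finset.in_setI ia.
have E : first_block a = find (fun C => good_rows a :&: C != finset.set0) Bs :> nat.
  by rewrite /first_block insubdK// unfold_in -has_find.
split.
  have := nth_find finset.set0 hasa; rewrite -E => /finset.set0Pn[j].
  by rewrite finset.in_setI => /andP[]; exists j.
apply/fintype.subsetP => w wa; rewrite in_Vt; apply/forallP => t'.
have := before_find finset.set0 (leq_trans (ltn_ord t') (eq_leq E)).
move=> /negbT; rewrite negbK => /eqP e0; apply/negP => wt.
have : w \in good_rows a :&: B t' by rewrite finset.in_setI wa.
by rewrite e0 finset.in_set0.
Qed.

Let A : {set 'I_k} := [set a | good_rows a != finset.set0].

Lemma first_block_inj : {in A &, injective first_block}.
Proof.
move=> a b; rewrite !finset.in_set => /first_blockP[[i ia it] _].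
move=> /first_blockP[[j jb jt] _] ab; rewrite -ab in jt.
move: ia jb; rewrite !in_good_rows => /andP[/eqP <- ib] /andP[/eqP <- jb].
exact: block_pure (ltn_ord _) it jt ib jb.
Qed.

Lemma sum_card_good : (\sum_(a in A) #|good_rows a| + #|bad_rows| = n)%N.
Proof.
rewrite -[RHS](card_ord n) -(cardsC bad_rows) addnC; congr (_ + _)%N.
rewrite -[RHS]sum1_card (partition_big s predT)//= [LHS]big_mkcond.
apply: eq_bigr => a _; rewrite [X in (if X then _ else _)]finset.inE.
case: ifPn => [_|/negPn/eqP a0].
  rewrite -sum1_card; apply: eq_bigl => i.
  rewrite in_good_rows finset.in_setC andbC; reflexivity.
rewrite big1// => i; rewrite finset.in_setC => /andP[ib ia].
have : i \in good_rows a by rewrite in_good_rows ia.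
by rewrite a0 finset.in_set0.
Qed.

Lemma card_bigcup_le (I : finType) (Q : pred I) (C : I -> {set 'I_n}) :
  (#|\bigcup_(t | Q t) C t| <= \sum_(t | Q t) #|C t|)%N.
Proof.
elim/big_rec2 : _ => [|t m D _ h]; first by rewrite finset.cards0.
by rewrite (leq_trans (leq_card_setU _ _))// leq_add2l.
Qed.

Let F : {set 'I_(size Bs)} := first_block @: A.
Let S : {set 'I_(size Bs)} := [set t | t \in codom sel].

Lemma card_good_le_first a : a \in A -> (#|good_rows a| <= #|B (first_block a)|)%N.
Proof.
rewrite finset.in_set => /first_blockP[_ /finset.setIidPl aV].
by have [u [_ /(_ a)]] := block_ballP (ltn_ord (first_block a)); rewrite aV.
Qed.

(** The selected blocks are the [k] largest and [F] has at most [k] members, so the selection covers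
    at least as much as [F], hence at least the number of good rows. At most the number of bad rows
    remains outside. *)
Lemma unselected_mass : (\sum_(t in F :\: S) #|B t| <= #|bad_rows|)%N.
Proof.
have FS : (\sum_(t in F) #|B t| <= \sum_(t in S) #|B t|)%N.
  apply: sum_card_select_le.
    rewrite (_ : #|S| = k) ?(leq_trans (leq_imset_card _ _))//.
      by rewrite -[leqRHS]card_ord max_card.
    by rewrite finset.cardsE card_codom// card_ord.
  move=> t t' _; rewrite !finset.inE => tS /codomP[j ->].
  exact: sel_large.
have Fge : (\sum_(a in A) #|good_rows a| <= \sum_(t in F) #|B t|)%N.
  rewrite big_imset /=; last exact: first_block_inj.
  by apply: leq_sum => a; exact: card_good_le_first.
have tot : (\sum_(t in S) #|B t| + \sum_(t in F :\: S) #|B t| <= n)%N.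
  rewrite -[leqRHS](card_ord n) -finset.cardsT -sum_card_blocks.
  rewrite [leqRHS](bigID (mem S)) /=.
  under [X in (_ <= X + _)%N]eq_bigr do rewrite finset.setIT.
  rewrite leq_add2l [leqLHS]big_mkcond [leqRHS]big_mkcond leq_sum// => t _.
  by rewrite finset.setIT finset.in_setD; case: (t \in S) => //=; case: ifP.
by have := sum_card_good; lia.
Qed.

(** As the first block is at least as large as [good_rows a], the good rows it misses are no more
    numerous than its elements outside [good_rows a]. Purity makes the latter bad, and the blocks
    are disjoint. *)
Lemma misplaced_mass :
  (\sum_(a in A) #|good_rows a :\: B (first_block a)| <= #|bad_rows|)%N.
Proof.
apply: (@leq_trans (\sum_(t in F) #|B t :&: bad_rows|)).
  rewrite big_imset /=; last exact: first_block_inj.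
  apply: leq_sum => a aA; rewrite finset.cardsD.
  apply: (@leq_trans #|B (first_block a) :\: good_rows a|).
    by rewrite finset.cardsD finset.setIC leq_sub2r ?card_good_le_first.
  apply: subset_leq_card; apply/fintype.subsetP => i.
  rewrite finset.in_setD finset.in_setI => /andP[ia iB]; rewrite iB /=.
  apply: contraNT ia => ib.
  move: aA; rewrite finset.in_set => /first_blockP[[j ja jB] _].
  move: ja; rewrite !in_good_rows ib andbT => /andP[/eqP <- jb].
  by apply/eqP; exact: block_pure (ltn_ord _) iB jB ib jb.
rewrite -(sum_card_blocks bad_rows) [leqLHS]big_mkcond leq_sum// => t _.
by case: ifP.
Qed.

Lemma exists_matching :
  exists p : {perm 'I_k}, (mismatch sig s p <= 3 * #|bad_rows|)%N.
Proof.
(* A cluster is sent to the label of its first block; the pick succeeds on [A'], where that block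
   was selected. *)
pose f a := odflt a [pick j | sel j == first_block a].
pose A' : {set 'I_k} := [set a in A | first_block a \in S].
have fP a : a \in A' -> sel (f a) = first_block a.
  rewrite !inE => /andP[_ /codomP[j aj]]; rewrite /f.
  by case: pickP => [j' /eqP //|/(_ j)]; rewrite aj eqxx.
have f_inj : {in A' &, injective f}.
  move=> a b aA bA fab; have : first_block a = first_block b.
    by rewrite -!fP// fab.
  by apply: first_block_inj; move: aA bA; rewrite !inE => /andP[? _] /andP[? _].
have [p pf] := perm_extend f_inj; exists p.
(* A mismatch is a bad row, or a row in an unselected first block ([X]), or a good row outside the
   first block of its cluster ([Z]); each set has at most [#|bad_rows|] elements. *)
pose X := \bigcup_(t in F :\: S) B t.
pose Z := \bigcup_(a in A) (good_rows a :\: B (first_block a)).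
apply: (@leq_trans #|bad_rows :|: X :|: Z|).
  apply: subset_leq_card; apply/fintype.subsetP => i; rewrite inE => mis.
  rewrite !finset.in_setU; apply/negPn/negP; rewrite !negb_or => /andP[/andP[ib iX] iZ].
  have ia : i \in good_rows (s i) by rewrite in_good_rows eqxx.
  have aA : s i \in A by rewrite inE; apply/finset.set0Pn; exists i.
  have iB : i \in B (first_block (s i)).
    apply: contraNT iZ => iB; apply/bigcupP; exists (s i) => //.
    by rewrite finset.in_setD iB.
  have tS : first_block (s i) \in S.
    apply: contraNT iX => tS; apply/bigcupP; exists (first_block (s i)) => //.
    by rewrite finset.in_setD tS imset_f.
  have aA' : s i \in A' by rewrite inE aA.
  move: iB; rewrite -(fP _ aA') => /(fintype.subsetP (sel_sig _)).
  rewrite inE => /eqP sigi; move: mis.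
  by rewrite pf// sigi eqxx.
rewrite (leq_trans (leq_card_setU _ _))// !mulSn mul0n addn0 addnA leq_add//.
  rewrite (leq_trans (leq_card_setU _ _))// leq_add2l.
  exact: leq_trans (card_bigcup_le _ _) unselected_mass.
exact: leq_trans (card_bigcup_le _ _) misplaced_mass.
Qed.

End Rounding.

Section RoundingError.
Context {R : realType} {n k : nat}.
Variables (Y : 'M[R]_n) (s sig : 'I_n -> 'I_k).
Hypothesis n4 : (4 <= n)%N.
Hypothesis k2 : (2 <= k)%N.
Hypothesis kn : (k %| n)%N.
Hypothesis bals : balanced s.

Lemma balancedE a : #|[pred i | s i == a]| = (n %/ k)%N.
Proof. by rewrite -(bals a) finset.cardsE. Qed.

Let n0 : (0 < n)%N. Proof. by lia. Qed.
Let k0 : (0 < k)%N. Proof. by lia. Qed.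

Lemma cluster_size : n%:R / k%:R = (n %/ k)%:R :> R.
Proof.
have kR : k%:R != 0 :> R by rewrite pnatr_eq0 -lt0n.
by rewrite -{1}(divnK kn) natrM mulfK.
Qed.

Lemma cluster_size_gt0 : 0 < (n %/ k)%:R :> R.
Proof. by rewrite -cluster_size divr_gt0 ?ltr0n. Qed.

Lemma l1_Ystar : l1 (Ystar s) = n%:R * (n %/ k)%:R :> R.
Proof.
rewrite /l1 (eq_bigr (fun=> (n %/ k)%:R)); first by rewrite sumr_const card_ord mulr_natl.
move=> i _; rewrite -(@Ystar_rowsum _ _ _ s (n %/ k)%:R _ i).
  by apply: eq_bigr => j _; rewrite mxE normr_nat.
by move=> a; rewrite balancedE.
Qed.

Lemma err_le_bad (m : nat) (p : {perm 'I_k}) :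
  (mismatch sig s p <= m)%N -> err sig s <= m%:R / n%:R :> R.
Proof.
move=> pm; rewrite /err ler_wpM2r ?invr_ge0// ler_nat.
exact: leq_trans (bigminn_le _ _ p) pm.
Qed.

(** The factor 24 is 3 mismatches per bad row times 8 from [card_bad_rows]. *)
Lemma rounding_error_le : cluster_out Y sig ->
  err sig s <= 24 * (l1 (Y - Ystar s) / l1 (Ystar s)).
Proof.
case=> Bs [st [sel [selI selL selS _]]].
have [p pm] := exists_matching k0 balancedE kn n0 st selI selL selS.
apply: le_trans (err_le_bad pm) _.
have l0 := cluster_size_gt0.
have nR : 0 < n%:R :> R by rewrite ltr0n.
have := card_bad_rows Y s; rewrite l1_Ystar natrM => h.
set L := l1 _ in h *; set c := (n %/ k)%:R in l0 h *.
have -> : 24 * (L / (n%:R * c)) = 24 * L / c / n%:R.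
  by field; rewrite !gt_eqF.
by rewrite ler_wpM2r ?invr_ge0 ?(ltW nR)// ler_pdivlMr//; lra.
Qed.

End RoundingError.

(** * The high-probability event *)

Section SurrogateMean.
Context {R : realType} {dT : measure_display} {T : measurableType dT}.
Variables (P : probability T R) (n k d : nat) (g : 'I_n -> T -> 'rV[R]_d).
Variables (s : 'I_n -> 'I_k) (mu : 'I_k -> 'rV[R]_d) (tau ell Delta2 : R).
Hypothesis mg : forall i j, measurable_fun setT (fun w => g i w ord0 j).
Hypothesis indep : indep_rvecs P g.
Hypothesis tau0 : 0 < tau.
Hypothesis subg : forall i, (subg_norm P (g i) <= tau%:E)%E.
Hypothesis Delta20 : 0 < Delta2.
Hypothesis sep : forall a b, a != b -> Delta2 <= sqnorm (mu a - mu b).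

Let V (J : {set 'I_n}) (i : 'I_n) (b : 'I_k) (w : T) :=
  decoupled_vec s mu ell J (fun j => g j w) (s i) b.
Let delta : R := expR (- (Delta2 / (128 * (64 * (2 * tau) ^+ 2)))).

Definition surrogate_mean (w : T) : R :=
  (\sum_(J : {set 'I_n}) \prod_(i | i \notin J)
    surrogate s mu (fun j => g j w) ell Delta2 ((2 * tau) ^+ 2) J i)
  / #|{set 'I_n}|%:R.

(** Measurability is asked for indices in [J] only, so the result also holds for the sigma-algebra
    of the vectors other than [g i] when [i] is outside [J]. The map [X] covers both uses. *)
Lemma measurable_decoupled_vec dX (TX : measurableType dX) (X : TX -> T)
    (J : {set 'I_n}) a b l :
  (forall j l, j \in J -> measurable_fun [set: TX] (fun w => g j (X w) 0 l)) ->
  measurable_fun [set: TX]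
    (fun w => decoupled_vec s mu ell J (fun j => g j (X w)) a b 0 l).
Proof.
move=> mX.
have mavg c : measurable_fun [set: TX]
    (fun w => partial_avg s ell J (fun j => g j (X w)) c 0 l).
  under eq_fun do rewrite mxE summxE big_mkcond.
  apply: measurable_funM => //; apply: measurable_sum => j.
  case E : ((j \in J) && (s j == c)); last exact: measurable_cst.
  by apply: mX; case/andP: E.
have -> : (fun w => decoupled_vec s mu ell J (fun j => g j (X w)) a b 0 l) =
  (fun w => mu b 0 l - mu a 0 l + 2 *
    (partial_avg s ell J (fun j => g j (X w)) b 0 l -
     partial_avg s ell J (fun j => g j (X w)) a 0 l)).
  by apply/funext => w; rewrite /decoupled_vec !mxE.
apply: measurable_funD => //; apply: measurable_funM => //.
exact: measurable_funB.
Qed.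

Let S i b : R := 4 * sqnorm (mu b - mu (s i)).
Let p i (b : 'I_k) := b != s i.

Let fac (J : {set 'I_n}) i w := decoupled_factor g tau (V J) p S delta i w w.

(** True by conversion, since [surrogate] and [decoupled_factor] share one shape. *)
Lemma surrogate_meanE w :
  surrogate_mean w = (\sum_(J : {set 'I_n}) \prod_(i | i \notin J) fac J i w)
    / #|{set 'I_n}|%:R.
Proof. by []. Qed.

Let N0 : 0 < #|{set 'I_n}|%:R :> R.
Proof. by rewrite ltr0n; apply/card_gt0P; exists finset.set0. Qed.

Let delta0 : 0 <= delta. Proof. exact: expR_ge0. Qed.

Let S0 i b : p i b -> 0 < S i b.
Proof.
by move=> bi; rewrite mulr_gt0//; apply: lt_le_trans Delta20 _; exact: sep.
Qed.

Let fac_ge0 (J : {set 'I_n}) i w : 0 <= fac J i w.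
Proof. exact: le_trans ler01 (decoupled_factor_ge1 _ _ _ _ _ delta0 _ _ _). Qed.

Lemma surrogate_mean_ge1 w : 1 <= surrogate_mean w.
Proof.
rewrite surrogate_meanE ler_pdivlMr// mul1r -sum1_card natr_sum.
apply: ler_sum => J _; elim/big_rec : _ => // i y _ y1.
by rewrite -[1]mulr1 ler_pM// decoupled_factor_ge1.
Qed.

Let measurable_prod_fac (J : {set 'I_n}) :
  measurable_fun setT (fun w => \prod_(i | i \notin J) fac J i w).
Proof.
under eq_fun do rewrite -big_filter.
apply: measurable_prod => i _.
apply: (@measurable_decoupled_factor _ _ _ _ _ _ _ _ _ _ _ _ _ T i id id).
- move=> b l; apply: (@measurable_decoupled_vec _ _ id) => j l' _; exact: mg.
- by move=> l; exact: mg.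
Qed.

Lemma measurable_surrogate_mean : measurable_fun setT surrogate_mean.
Proof.
apply: measurable_funM => //; apply: measurable_sum => J.
exact: measurable_prod_fac.
Qed.

Lemma integral_surrogate_mean :
  (\int[P]_w (surrogate_mean w)%:E <= ((1 + 2 * delta) ^+ n)%:E)%E.
Proof.
under eq_integral do rewrite surrogate_meanE mulrC EFinM -sumEFin.
rewrite ge0_integralZl_EFin ?invr_ge0 ?(ltW N0)//; last 2 first.
- move=> w _; rewrite sumEFin lee_fin; apply: sumr_ge0 => J _.
  by apply: prodr_ge0 => i _; exact: fac_ge0.
- apply: emeasurable_sum => J; apply/measurable_EFinP; exact: measurable_prod_fac.
rewrite ge0_integral_sum//; last 2 first.
- by move=> J; apply/measurable_EFinP; exact: measurable_prod_fac.
- move=> J w _; rewrite lee_fin.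
  by apply: prodr_ge0 => i _; exact: fac_ge0.
apply: (@le_trans _ _ ((#|{set 'I_n}|%:R^-1)%:E *
    \sum_(J : {set 'I_n}) ((1 + 2 * delta) ^+ n)%:E)%E).
  rewrite lee_wpmul2l ?lee_fin ?invr_ge0 ?(ltW N0)//.
  apply: lee_sum => J _; apply: (decoupled_mgf mg indep) => //.
  move=> i iJ i' b l; apply: (@measurable_decoupled_vec _ (others_type g i) id).
  move=> j l' jJ; apply: measurable_coord_others.
  by apply: contraNneq iJ => <-.
rewrite sumEFin -EFinM lee_fin sumr_const -[X in _ * X]mulr_natl mulrA mulVf ?mul1r//.
by rewrite gt_eqF.
Qed.

End SurrogateMean.

(** * Choice of the level in Markov's inequality *)

Section Thresholds.
Context {R : realType}.
Implicit Types x beta : R.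

Lemma expR_le_1D2x x : 0 <= x -> x <= 2^-1 -> expR x <= 1 + 2 * x.
Proof.
move=> x0 x2; have h := expR_ge1Dx (- x).
have e0 := expR_gt0 x.
have : expR x * (1 - x) <= 1.
  by rewrite -[leRHS](expRxMexpNx_1 x) ler_wpM2l// ltW.
nra.
Qed.

(** The hypothesis gives [n <= (n * beta) ^+ 2], and the logarithm of [n * beta] is below
    [n * beta]. *)
Lemma ln_le_mul (n : nat) beta : (4 <= n)%N -> 0 < beta -> 1 < beta ^+ 2 * n%:R ->
  ln n%:R <= 2 * (n%:R * beta).
Proof.
move=> n4 b0 bn.
have n0 : 0 < n%:R :> R by rewrite ltr0n; lia.
have nb0 : 0 < n%:R * beta by rewrite mulr_gt0.
have h : n%:R <= (n%:R * beta) ^+ 2 :> R.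
  have := ler_wpM2l (ltW n0) (ltW bn); rewrite mulr1; nra.
apply: (@le_trans _ _ (ln ((n%:R * beta) ^+ 2))).
  by rewrite ler_ln ?posrE ?exprn_gt0.
by rewrite lnXn// -[leLHS]mulr_natl ler_wpM2l// ltW// ln_sublinear.
Qed.

(* Two regimes: for beta^2 n <= 1 Markov is applied to Z - 1, whose mean is at
   most 4 beta^4 n; otherwise it is applied to Z itself. *)
Lemma exists_threshold (n : nat) beta : (4 <= n)%N -> 0 < beta -> beta <= 1 ->
  exists t, [/\ t <= 4 * (n%:R * beta), 0 < t &
   ((1 + 2 * beta ^+ 4) ^+ n - 1) / t <= n%:R^-1 \/
   (1 + 2 * beta ^+ 4) ^+ n / expR t <= n%:R^-1].
Proof.
move=> n4 b0 b1.
have nR4 : 4 <= n%:R :> R by rewrite (ler_nat R 4 n).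
have n0 : 0 < n%:R :> R by apply: lt_le_trans nR4.
have d0 : 0 < beta ^+ 4 by exact: exprn_gt0.
have en : (1 + 2 * beta ^+ 4) ^+ n <= expR (2 * beta ^+ 4 * n%:R).
  rewrite expRM_natr lerXn2r ?nnegrE ?expR_ge0 ?expR_ge1Dx//.
  by rewrite addr_ge0// mulr_ge0// ltW.
have [bn|bn] := leP (beta ^+ 2 * n%:R) 1.
  have b4 : beta ^+ 4 * n%:R ^+ 2 <= 1.
    rewrite (_ : beta ^+ 4 * n%:R ^+ 2 = (beta ^+ 2 * n%:R) ^+ 2); last ring.
    by rewrite expr_le1// mulr_ge0// ltW// exprn_gt0.
  (* This is [n] times the bound [4 * beta ^+ 4 * n] on the mean of [Z - 1]; [4 <= n] keeps the
     exponent below one half, where [expR_le_1D2x] applies. *)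
  exists (4 * n%:R ^+ 2 * beta ^+ 4); split.
  - rewrite (_ : 4 * n%:R ^+ 2 * beta ^+ 4 =
      4 * (n%:R * beta) * (beta * (beta ^+ 2 * n%:R))); last ring.
    rewrite ler_piMr ?mulr_ge0 ?(ltW n0) ?(ltW b0)//.
    by rewrite mulr_ile1 ?mulr_ge0 ?sqr_ge0 ?(ltW n0) ?(ltW b0).
  - by rewrite !mulr_gt0// exprn_gt0.
  - left; rewrite ler_pdivrMr; last by rewrite !mulr_gt0// exprn_gt0.
    rewrite (_ : n%:R^-1 * _ = 2 * (2 * beta ^+ 4 * n%:R)); last first.
      by field; rewrite pnatr_eq0; lia.
    rewrite lerBlDl; apply: le_trans en _; apply: expR_le_1D2x.
      by rewrite mulr_ge0 ?(ltW n0)// mulr_ge0 ?(ltW d0).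
    have : 4 * (beta ^+ 4 * n%:R) <= 1.
      have h4 : 0 <= beta ^+ 4 * n%:R by rewrite mulr_ge0 ?(ltW n0) ?(ltW d0).
      have := ler_wpM2l h4 nR4; move: b4; rewrite (expr2 n%:R) mulrA; lra.
    lra.
(* The first summand absorbs the mean of [Z], the second yields the probability [n^-1]. *)
exists (2 * beta ^+ 4 * n%:R + ln n%:R); split.
- have := ln_le_mul n4 b0 bn.
  have : beta ^+ 4 * n%:R <= n%:R * beta.
    rewrite mulrC ler_wpM2l ?(ltW n0)//.
    by rewrite exprS ler_piMr ?(ltW b0)// exprn_ile1// ltW.
  lra.
- by rewrite addr_gt0 ?ln_gt0 ?mulr_gt0//; lra.
- right; rewrite expRD lnK ?posrE// invfM mulrA ler_piMl ?invr_ge0 ?(ltW n0)//.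
  by rewrite ler_pdivrMr ?expR_gt0// mul1r.
Qed.

End Thresholds.

Section ErrorEvent.
Context {R : realType} {dT : measure_display} {T : measurableType dT}.
Variables (P : probability T R) (n k d : nat) (g : 'I_n -> T -> 'rV[R]_d).
Variables (s : 'I_n -> 'I_k) (mu : 'I_k -> 'rV[R]_d) (tau Delta2 : R).
Hypothesis n4 : (4 <= n)%N.
Hypothesis k2 : (2 <= k)%N.
Hypothesis d0 : (0 < d)%N.
Hypothesis kn : (k %| n)%N.
Hypothesis bals : balanced s.
Hypothesis mg : forall i j, measurable_fun setT (fun w => g i w ord0 j).
Hypothesis indep : indep_rvecs P g.
Hypothesis tau0 : 0 < tau.
Hypothesis subg : forall i, (subg_norm P (g i) <= tau%:E)%E.
Hypothesis Delta20 : 0 < Delta2.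
Hypothesis sep : forall a b, a != b -> Delta2 <= sqnorm (mu a - mu b).
Hypothesis snr : 192 * 96 * ((k * d)%:R / n%:R + k%:R) <= Delta2 / tau ^+ 2.

Let ell : R := (n %/ k)%:R.
Let Lam : R := 96 * tau ^+ 2 * (n + d)%:R.
Let theta2 := (2 * tau) ^+ 2.
(** The fourth root of the weight in [surrogate]; the final error is of order [beta]. *)
Let beta := expR (- (Delta2 / (128 * (64 * theta2))) / 4).
Let Z := surrogate_mean g s mu tau ell Delta2.

Let nR : 0 < n%:R :> R. Proof. by rewrite ltr0n; lia. Qed.
Let kR : 0 < k%:R :> R. Proof. by rewrite ltr0n; lia. Qed.
Let tau20 : 0 < tau ^+ 2. Proof. exact: exprn_gt0. Qed.

Let theta20 : 0 < theta2.
Proof. by rewrite exprn_gt0// mulr_gt0. Qed.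

Let measurable_level (f : T -> R) c : measurable_fun setT f ->
  measurable [set w | c <= f w].
Proof.
move=> mf; have -> : [set w | c <= f w] = f @^-1` [set` `[c, +oo[].
  by apply/seteqP; split=> w /=; rewrite in_itv /= andbT.
by rewrite -[X in measurable X]setTI; exact: mf.
Qed.

Let delta_beta : expR (- (Delta2 / (128 * (64 * theta2)))) = beta ^+ 4.
Proof.
rewrite /beta -expRM_natr; congr expR.
by field; rewrite !gt_eqF ?exprn_gt0 ?mulr_gt0.
Qed.

Let mZ : measurable_fun setT Z.
Proof. exact: measurable_surrogate_mean. Qed.

Let intZ : (\int[P]_w (Z w)%:E <= ((1 + 2 * beta ^+ 4) ^+ n)%:E)%E.
Proof. by rewrite -delta_beta; exact: integral_surrogate_mean. Qed.

Let Z1 w : 1 <= Z w.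
Proof. exact: surrogate_mean_ge1. Qed.

Let surrogate_tail : exists2 t, t <= 4 * (n%:R * beta) &
  (P [set w | (expR t <= Z w)%R] <= (n%:R^-1)%:E)%E.
Proof.
have [||t [tn t0 h]] := @exists_threshold R n beta n4; first exact: expR_gt0.
  by rewrite -expR0 ler_expR mulNr oppr_le0 divr_ge0// divr_ge0 ?(ltW Delta20)//
    mulr_ge0// mulr_ge0// ltW.
exists t => //; case: h => h; last first.
  apply: le_trans (markov_ge mZ (fun w => le_trans ler01 (Z1 w)) (expR_gt0 t) intZ) _.
  by rewrite lee_fin.
have mZ' : measurable_fun setT (fun w => Z w - 1) by exact: measurable_funB.
have Z0' w : 0 <= Z w - 1 by rewrite subr_ge0.
have iZ' : (\int[P]_w (Z w - 1)%:E <= ((1 + 2 * beta ^+ 4) ^+ n - 1)%:E)%E.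
  rewrite EFinB leeBrDr//; apply: le_trans intZ.
  rewrite (_ : 1%E = \int[P]_w (cst 1%:E w))%E; last first.
    by rewrite integral_cst// mul1e [X in _ = X](probability_setT P).
  rewrite -ge0_integralD//.
  - apply: ge0_le_integral => //.
    + by move=> w _; rewrite adde_ge0// lee_fin.
    + by apply: emeasurable_funD => //; exact/measurable_EFinP.
    + exact/measurable_EFinP.
    + by move=> w _; rewrite -EFinD subrK.
  - by move=> w _; rewrite lee_fin.
  - exact/measurable_EFinP.
apply: (@le_trans _ _ (((1 + 2 * beta ^+ 4) ^+ n - 1) / t)%:E); last by rewrite lee_fin.
(* The event is enlarged: [expR t <= Z] implies [t <= Z - 1]. *)
apply: le_trans (markov_ge mZ' Z0' t0 iZ').
apply: le_measure; rewrite ?inE; [exact: measurable_level|exact: measurable_level|].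
by move=> w /= tw; rewrite lerBrDl (le_trans (expR_ge1Dx t)).
Qed.

Lemma error_event : exists E : set T, [/\ measurable E,
  ((1 - 2 / n%:R)%:E <= P E)%E &
  forall w, E w -> forall Y : 'M[R]_n,
    sdp_opt k (Amat (fun i => mu (s i) + g i w)) Y ->
    l1 (Y - Ystar s) <= 128 * ell * (4 * (n%:R * beta))].
Proof.
have [t tn PZ] := surrogate_tail.
(* [A1] contains the failures of the spectral bound and [A2] those of the exponential bound; each
   has probability at most [n^-1]. *)
pose A1 := [set w | expR (2 * (n + d)%:R) <= lattice_mgf g tau w].
pose A2 := [set w | expR t <= Z w].
have mA1 : measurable A1 by apply: measurable_level; exact: measurable_lattice_mgf.
have mA2 : measurable A2 by exact: measurable_level.
have PA1 : (P A1 <= (n%:R^-1)%:E)%E.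
  apply: le_trans (spectral_event mg indep tau0 subg d0) _.
  rewrite lee_fin expRN lef_pV2 ?posrE ?expR_gt0//.
  by apply: le_trans (expR_ge1Dx _); rewrite lerDr.
exists (~` (A1 `|` A2)); split; first by apply: measurableC; exact: measurableU.
  rewrite probability_setC; last exact: measurableU.
  rewrite EFinB leeB//.
  apply: le_trans (measureU2 _ mA1 mA2) _.
  rewrite (_ : (2 / n%:R)%:E = (n%:R^-1)%:E + (n%:R^-1)%:E)%E; first exact: leeD.
  by rewrite -EFinD; congr EFin; ring.
move=> w; rewrite setCU => -[/= /negP w1 /negP w2] Y optY.
rewrite -ltNge in w1; rewrite -ltNge in w2.
have l0 : 0 < ell by exact: cluster_size_gt0.
have lE : n%:R / k%:R = ell by exact: cluster_size.
have nE : n%:R = ell * k%:R by rewrite -lE divfK ?gt_eqF.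
apply: (@le_trans _ _ (128 * ell * t)); last first.
  by rewrite ler_wpM2l// mulr_ge0// ltW.
apply: (@l1_error_le R n k d s mu (fun i => g i w) ell Lam Delta2 theta2) => //.
- by rewrite mulr_ge0// mulr_ge0// ltW.
- by move=> a; rewrite balancedE.
- exact: (lattice_mgf_spectral tau0 d0 (ltW w1)).
(* Since [n = ell * k], multiplying the signal condition by [ell] turns [k * d / n + k] into
   [d + n]. *)
- move: snr; rewrite ler_pdivlMr// => h.
  have := ler_wpM2l (ltW l0) h.
  rewrite (mulrC ell Delta2); apply: le_trans.
  rewrite /Lam natrM natrD le_eqVlt; apply/orP; left; apply/eqP.
  by rewrite nE; field; rewrite !gt_eqF.
(* The requirement is [2048 * k * tau ^+ 2 <= Delta2], which the [k] part of the signal condition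
   covers. *)
- have : k%:R * (2 * 96 * 96) <= Delta2 / tau ^+ 2.
    apply: le_trans snr; rewrite (_ : 192 * 96 = 2 * 96 * 96 :> R); last ring.
    by rewrite mulrC ler_wpM2l// lerDr divr_ge0.
  rewrite ler_pdivlMr// => h; apply: le_trans h.
  rewrite /theta2; have : 0 <= k%:R * tau ^+ 2 by rewrite mulr_ge0// ltW.
  nra.
- exact: ltnW k2.
- by case: optY.
Qed.

End ErrorEvent.
Theorem theorem4 (R : realType) :
  (exists C : R, 0 < C /\
    forall (n k d : nat) (h : 'I_n -> 'rV[R]_d) (sstar : 'I_n -> 'I_k)
           (Yhat : 'M[R]_n) (sig : 'I_n -> 'I_k),
      (4 <= n)%N -> (2 <= k)%N -> (k %| n)%N -> balanced sstar ->
      sdp_opt k (Amat h) Yhat -> cluster_out Yhat sig ->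
      err sig sstar <= C * (l1 (Yhat - Ystar sstar) / l1 (Ystar sstar)))
  /\
  (exists Cs Cm Ce : R, [/\ 0 < Cs, 0 < Cm & 0 < Ce] /\
    forall (n k d : nat) (mu : 'I_k -> 'rV[R]_d) (sstar : 'I_n -> 'I_k)
           (tau Delta : R) (dT : measure_display) (T : measurableType dT)
           (P : probability T R) (g : 'I_n -> T -> 'rV[R]_d),
      (4 <= n)%N -> (2 <= k)%N -> (k %| n)%N -> balanced sstar ->
      0 < tau -> is_min_sep mu Delta ->
      (forall i j, measurable_fun setT (fun w => g i w 0 j)) ->
      indep_rvecs P g ->
      (forall i, (subg_norm P (g i) <= tau%:E)%E) ->
      Cs * (Num.sqrt ((k * d)%:R / n%:R * ln n%:R) + (k * d)%:R / n%:R + k%:R)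
        <= (Delta / tau) ^+ 2 ->
      exists E : set T, [/\ measurable E,
        ((1 - 2 / n%:R)%:E <= P E)%E &
        forall w, E w ->
          forall (Yhat : 'M[R]_n) (sig : 'I_n -> 'I_k),
            sdp_opt k (Amat (fun i => mu (sstar i) + g i w)) Yhat ->
            cluster_out Yhat sig ->
            err sig sstar <= Cm * expR (- ((Delta / tau) ^+ 2) / Ce)]).
Proof.
split.
  exists 24; split => // n k d h sstar Yhat sig n4 k2 kn bals _.
  exact: rounding_error_le.
(* [Cm] multiplies the rounding factor 24 by the constant 512 of [error_event]; [Ce] collects the
   denominators in [beta], where [theta2 = 4 * tau ^+ 2]. *)
exists (192 * 96), (24 * (128 * 4)), (4 * (128 * (64 * 4))).
split; first by split; rewrite !mulr_gt0.
move=> n k d mu sstar tau Delta dT T P g n4 k2 kn bals tau0 [[a [b [ab Dab]]] Dmin].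
move=> mg indep subg snr.
have n0 : 0 < n%:R :> R by rewrite ltr0n (leq_trans _ n4).
have k0 : 0 < k%:R :> R by rewrite ltr0n (leq_trans _ k2).
have D0 : 0 <= Delta by rewrite -Dab enorm_ge0.
have snr' : 192 * 96 * ((k * d)%:R / n%:R + k%:R) <= Delta ^+ 2 / tau ^+ 2.
  rewrite -expr_div_n; apply: le_trans snr; rewrite ler_wpM2l ?mulr_ge0//.
  by rewrite -addrA lerDr sqrtr_ge0.
(* Positive separation is forced by the signal condition, whose left side is positive. *)
have Delta20 : 0 < Delta ^+ 2.
  have t20 : 0 < tau ^+ 2 by rewrite exprn_gt0.
  have : 0 < Delta ^+ 2 / tau ^+ 2.
    apply: lt_le_trans snr'; rewrite !mulr_gt0//.
    by rewrite ltr_wpDl// divr_ge0.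
  by rewrite pmulr_lgt0 ?invr_gt0.
have sep a' b' : a' != b' -> Delta ^+ 2 <= sqnorm (mu a' - mu b').
  move=> /Dmin h; rewrite -sqr_enorm ler_sqr ?nnegrE//; exact: enorm_ge0.
(* In dimension 0 all distances vanish, contradicting the positive separation. *)
have d0 : (0 < d)%N.
  rewrite lt0n; apply/eqP => dz; move: Delta20.
  rewrite -Dab sqr_enorm /sqnorm big1 ?ltxx// => l _.
  by have := ltn_ord l; rewrite {2}dz.
have [E [mE PE hE]] := error_event n4 k2 d0 kn bals mg indep tau0 subg Delta20 sep snr'.
exists E; split => // w Ew Y sig optY clY.
apply: le_trans (rounding_error_le n4 k2 kn bals clY) _.
have l0 := @cluster_size_gt0 R n k n4 k2 kn.
rewrite (l1_Ystar bals).
have := hE w Ew Y optY.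
set be := expR _ => h.
have -> : expR (- (Delta / tau) ^+ 2 / (4 * (128 * (64 * 4)))) = be.
  by congr expR; field; rewrite ?gt_eqF.
rewrite -[X in _ <= X]mulrA ler_wpM2l// ler_pdivrMr ?mulr_gt0//.
by apply: le_trans h _; lra.
Qed.
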